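(* Let $F,f:\mathbb R^n\times\mathbb R^m\to\mathbb R$, $G:\mathbb R^n\times\mathbb R^m\to\mathbb R^q$, $g:\mathbb R^n\times\mathbb R^m\to\mathbb R^p$ be continuously differentiable such that for each fixed $x$, $f(x,\cdot)$ is weakly convex and each component of $g(x,\cdot)$ is quasi-convex. Let $\gamma>0$ and let $(\bar x,\bar y)$ be a local minimizer of the problem $$(\mathrm{VP})_\gamma\qquad\min_{x,y}F(x,y)\quad\text{s.t. } f(x,y)-v_\gamma(x,y)\le0,\ g(x,y)\le0,\ G(x,y)\le0.$$ Suppose that the function $v_\gamma$ is directionally Lipschitz continuous at $(\bar x,\bar y)$ in a direction $(u,v)\in C(\bar x,\bar y)$, the critical cone of $(\mathrm{VP})_\gamma$. Moreover, suppose that $(\mathrm{VP})_\gamma$ is either calm or partially calm at $(\bar x,\bar y)$ in direction $(u,v)$, and that MSCQ holds for the system $g(x,y)\le0$ at $(\bar x,\bar y)$ in direction $(u,v)$. Then there exists $(\alpha,\lambda_g,\lambda_G)\in\mathbb R^{1+p+q}$ such that $$0\in\nabla F(\bar x,\bar y)+\alpha\nabla f(\bar x,\bar y)-\alpha\,\partial^cv_\gamma(\bar x,\bar y;u,v)+\nabla g(\bar x,\bar y)^T\lambda_g+\nabla G(\bar x,\bar y)^T\lambda_G,$$ $$\alpha\ge0,\quad0\le\lambda_g\perp g(\bar x,\bar y),\quad\lambda_g\perp\nabla g(\bar x,\bar y)(u,v),\quad0\le\lambda_G\perp G(\bar x,\bar y),\quad\lambda_G\perp\nabla G(\bar x,\bar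 y)(u,v).$$
   Context: Definitions. $\mathcal F(x):=\{y\in\mathbb R^m\mid g(x,y)\le0\}$; the Moreau envelope function is $v_\gamma(x,y):=\inf_w\{f(x,w)+\frac1{2\gamma}\|w-y\|^2\mid g(x,w)\le0\}$. Weakly convex: $h+\frac\rho2\|\cdot\|^2$ is convex for some $\rho\ge0$. Quasi-convex: all sublevel sets are convex. $I_g(x,y):=\{i\mid g_i(x,y)=0\}$, and similarly $I_G$; $\nabla g(x,y)(u,v)$ is the Jacobian applied to $(u,v)$; $a\perp b$ means $\langle a,b\rangle=0$; $\mathbb B$ is the open unit ball; $a_+$ is the componentwise positive part. Directional neighborhood: $\mathcal V_{\epsilon,\delta}(d):=\{z\in\epsilon\mathbb B\mid\big\|\|d\|z-\|z\|d\big\|\le\delta\|z\|\|d\|\}$. Directionally Lipschitz at $\bar z$ in direction $d$: Lipschitz on $\bar z+\mathcal V_{\epsilon,\delta}(d)$ for some $\epsilon,\delta>0$. $\psi'_+(z;d):=\limsup_{t\downarrow0}\frac{\psi(z+td)-\psi(z)}t$. Critical cone: $C(\bar x,\bar y):=\{(u,v)\mid\nabla f(\bar x,\bar y)(u,v)\le(v_\gamma)'_+(\bar x,\bar y;u,v),\ \nabla F(\bar x,\bar y)(u,v)\le0,\ \nabla g_i(\bar x,\bar y)(u,v)\le0\ \forall i\in I_g(\bar x,\bar y),\ \nabla G_i(\bar x,\bar y)(u,v)\le0\ \forall i\in I_G(\bar x,\bar y)\}$. Calmness of $(\mathrm{VP})_\gamma$ at $(\bar x,\bar y)$ in direction $(u,v)$: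 with $\phi:=(f-v_\gamma,g,G)$, there are $\epsilon,\delta,\rho>0$ such that for every $\alpha\in\epsilon\mathbb B\subset\mathbb R^{1+p+q}$ and every $(x,y)\in(\bar x,\bar y)+\mathcal V_{\epsilon,\delta}(u,v)$ with $\phi(x,y)+\alpha\le0$ one has $F(x,y)-F(\bar x,\bar y)+\rho\|\alpha\|\ge0$. Partial calmness of $(\mathrm{VP})_\gamma$ at $(\bar x,\bar y)$ in direction $(u,v)$: there are $\epsilon,\delta,\rho>0$ such that for every $(\alpha,\beta)\in\epsilon\mathbb B\subset\mathbb R^{1+q}$ and every $(x,y)\in\operatorname{gph}\mathcal F\cap((\bar x,\bar y)+\mathcal V_{\epsilon,\delta}(u,v))$ with $f(x,y)-v_\gamma(x,y)+\alpha\le0$ and $G(x,y)+\beta\le0$ one has $F(x,y)-F(\bar x,\bar y)+\rho\|(\alpha,\beta)\|\ge0$. MSCQ for $g(x,y)\le0$ at $(\bar x,\bar y)$ in direction $(u,v)$: there are $\epsilon,\delta,\kappa>0$ with $\operatorname{dist}((x,y),\{g\le0\})\le\kappa\|g_+(x,y)\|$ for all $(x,y)\in(\bar x,\bar y)+\mathcal V_{\epsilon,\delta}(u,v)$. $\partial\psi(\bar z;d)$ is the set of limits of $\xi^k\in\widehat\partial\psi(\bar z+t_kd^k)$ with $t_k\downarrow0$, $d^k\to d$, $\psi(\bar z+t_kd^k)\to\psi(\bar z)$, where $\widehat\partial\psi(z):=\{\xi\mid\psi(z')\ge\psi(z)+\langle\xi,z'-z\rangle+o(\|z'-z\|)\}$;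 $\partial^c\psi(\bar z;d):=\operatorname{co}\partial\psi(\bar z;d)$. *)

(* Defs.v *)
From HB Require Import structures.
From mathcomp Require Import all_boot all_order all_algebra.
From mathcomp Require Import all_classical all_reals all_analysis.

Set Implicit Arguments.
Unset Strict Implicit.
Unset Printing Implicit Defensive.

Import Order.TTheory GRing.Theory Num.Theory.
Import numFieldNormedType.Exports.

Local Open Scope classical_set_scope.
Local Open Scope ring_scope.

(* The library norm on 'rV[R]_n and on products is the sup norm. It is only
   used for topology and differentiability; every norm, ball, inner product and
   distance below is Euclidean. *)

Section Euclidean.
Context {R : realType}.

Definition dot k (a b : 'rV[R]_k) : R := \sum_i a 0 i * b 0 i.

Definition enorm k (a : 'rV[R]_k) : R := Num.sqrt (dot a a).

Definition pdot n m (a b : 'rV[R]_n * 'rV[R]_m) : R :=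
  dot a.1 b.1 + dot a.2 b.2.

Definition penorm n m (a : 'rV[R]_n * 'rV[R]_m) : R := Num.sqrt (pdot a a).

Definition vnonpos k (a : 'rV[R]_k) : Prop := forall i, a 0 i <= 0.

Definition vnonneg k (a : 'rV[R]_k) : Prop := forall i, 0 <= a 0 i.

Definition vpos_part k (a : 'rV[R]_k) : 'rV[R]_k :=
  map_mx (fun t => Num.max t 0) a.

End Euclidean.

Section Convexity.
Context {R : realType} {m : nat}.

Definition weakly_convex (h : 'rV[R]_m -> R) : Prop :=
  exists2 rho : R, 0 <= rho &
    convex_function setT (fun y => h y + rho / 2 * enorm y ^+ 2).

Definition quasi_convex (h : 'rV[R]_m -> R) : Prop :=
  forall c : R, convex_set [set y | h y <= c].

End Convexity.

Section Calculus.
Context {R : realType} {n m : nat}.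
Local Notation E := ('rV[R]_n * 'rV[R]_m)%type.

(* In finite dimension, continuity of z |-> 'd h z d for every d is continuity
   of the derivative. *)
Definition C1 (W : normedModType R) (h : E -> W) : Prop :=
  (forall z, differentiable h z) /\ (forall d, continuous (fun z => 'd h z d)).

(* Vector of partial derivatives, so that 'd h z d = pdot (grad h z) d. *)
Definition grad (h : E -> R) (z : E) : E :=
  (\row_i 'd h z (delta_mx 0 i, 0), \row_j 'd h z (0, delta_mx 0 j)).

(* The transposed Jacobian applied to l: (J^T l)_i = <J e_i, l>. *)
Definition jacT k (h : E -> 'rV[R]_k) (z : E) (l : 'rV[R]_k) : E :=
  (\row_i dot ('d h z (delta_mx 0 i, 0)) l,
   \row_j dot ('d h z (0, delta_mx 0 j)) l).

Definition dir_nbhd (eps del : R) (d : E) : set E :=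
  [set z | penorm z < eps /\
    penorm (penorm d *: z - penorm z *: d) <= del * penorm z * penorm d].

(* Being Lipschitz on a set includes being finite there. *)
Definition dir_lipschitz (psi : E -> \bar R) (zb d : E) : Prop :=
  exists eps del L : R, [/\ 0 < eps, 0 < del,
    (forall z, dir_nbhd eps del d (z - zb) -> psi z \is a fin_num) &
    forall z z', dir_nbhd eps del d (z - zb) -> dir_nbhd eps del d (z' - zb) ->
      `|fine (psi z) - fine (psi z')| <= L * penorm (z - z')].

Definition upper_dini (psi : E -> \bar R) (z d : E) : \bar R :=
  limf_esup (fun t : R => (psi (z + t *: d)%R - psi z) * (t^-1)%:E)%E 0^'+.

Definition reg_subdiff (psi : E -> \bar R) (z : E) : set E :=
  [set xi | psi z \is a fin_num /\
    forall e : R, 0 < e -> \forall z' \near z,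
      (psi z + (pdot xi (z' - z) - e * penorm (z' - z))%:E <= psi z')%E].

Definition dir_lim_subdiff (psi : E -> \bar R) (zb d : E) : set E :=
  [set xi | exists (t : nat -> R) (dk xik : nat -> E),
    [/\ (forall k, 0 < t k), t k @[k --> \oo] --> (0 : R),
        dk k @[k --> \oo] --> d,
        psi (zb + t k *: dk k) @[k --> \oo] --> psi zb &
        (forall k, reg_subdiff psi (zb + t k *: dk k) (xik k)) /\
        xik k @[k --> \oo] --> xi]].

Definition dir_clarke_subdiff (psi : E -> \bar R) (zb d : E) : set E :=
  smallest (@convex_set R E) (dir_lim_subdiff psi zb d).

(* Extended-valued, so that the distance to the empty set is +oo. *)
Definition edist_set (z : E) (A : set E) : \bar R :=
  ereal_inf [set (penorm (z - a))%:E | a in A].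

End Calculus.

Section Problem.
Context {R : realType} {n m p q : nat}.
Local Notation E := ('rV[R]_n * 'rV[R]_m)%type.
Implicit Types (F f : E -> R) (g : E -> 'rV[R]_p) (G : E -> 'rV[R]_q).

Definition lower_feasible g (x : 'rV[R]_n) : set 'rV[R]_m :=
  [set y | vnonpos (g (x, y))].

Definition moreau f g (gamma : R) (z : E) : \bar R :=
  ereal_inf [set (f (z.1, w) + (2 * gamma)^-1 * enorm (w - z.2) ^+ 2)%:E |
             w in lower_feasible g z.1].

Definition VP_feasible f g G gamma : set E :=
  [set z | [/\ ((f z)%:E - moreau f g gamma z <= 0)%E,
               vnonpos (g z) & vnonpos (G z)]].

Definition VP_local_min F f g G gamma (zb : E) : Prop :=
  VP_feasible f g G gamma zb /\
  \forall z \near zb, VP_feasible f g G gamma z -> F zb <= F z.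

Definition critical_cone F f g G gamma (zb : E) : set E :=
  [set d | [/\ (('d f zb d : R)%:E <= upper_dini (moreau f g gamma) zb d)%E,
      ('d F zb d : R) <= 0,
      (forall i, g zb 0 i = 0 -> 'd g zb d 0 i <= 0) &
      (forall i, G zb 0 i = 0 -> 'd G zb d 0 i <= 0)]].

Definition VP_calm F f g G gamma (zb d : E) : Prop :=
  exists eps del rho : R, [/\ 0 < eps, 0 < del, 0 < rho &
    forall (a : R) (b : 'rV[R]_p) (c : 'rV[R]_q) (z : E),
      Num.sqrt (a ^+ 2 + dot b b + dot c c) < eps ->
      dir_nbhd eps del d (z - zb) ->
      ((f z)%:E - moreau f g gamma z + a%:E <= 0)%E ->
      vnonpos (g z + b) -> vnonpos (G z + c) ->
      0 <= F z - F zb + rho * Num.sqrt (a ^+ 2 + dot b b + dot c c)].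

Definition VP_partially_calm F f g G gamma (zb d : E) : Prop :=
  exists eps del rho : R, [/\ 0 < eps, 0 < del, 0 < rho &
    forall (a : R) (b : 'rV[R]_q) (z : E),
      Num.sqrt (a ^+ 2 + dot b b) < eps ->
      lower_feasible g z.1 z.2 ->
      dir_nbhd eps del d (z - zb) ->
      ((f z)%:E - moreau f g gamma z + a%:E <= 0)%E ->
      vnonpos (G z + b) ->
      0 <= F z - F zb + rho * Num.sqrt (a ^+ 2 + dot b b)].

Definition dir_MSCQ g (zb d : E) : Prop :=
  exists eps del kappa : R, [/\ 0 < eps, 0 < del, 0 < kappa &
    forall z, dir_nbhd eps del d (z - zb) ->
      (edist_set z [set z' | vnonpos (g z')] <=
         (kappa * enorm (vpos_part (g z)))%:E)%E].

End Problem.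

(* Main.v *)
Require Import Defs.
From HB Require Import structures.
From mathcomp Require Import all_boot all_order all_algebra.
From mathcomp Require Import all_classical all_reals all_analysis.
From mathcomp Require Import lra.

Import Order.TTheory GRing.Theory Num.Theory.
Import numFieldNormedType.Exports.

Set Implicit Arguments.
Unset Strict Implicit.
Unset Printing Implicit Defensive.

Local Open Scope classical_set_scope.
Local Open Scope ring_scope.

(** The theorem is a first-order argument for the exact penalty function
    [F + rho * penalty], where the penalty adds up the violations of
    [f - v_gamma <= 0], [g <= 0] and [G <= 0].

    Calmness in direction [d = (u, v)] says that [zb = (xb, yb)] minimises this
    function over a directional neighborhood ([calm_cone_min]). Partial calmness
    gives this only at points with [g <= 0]; metric subregularity provides such a
    point at a distance controlled by the violation of [g], which is a small
    multiple of the step because [d] is critical, so that this point stays in the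
    neighborhood ([partially_calm_cone_min]).

    Criticality of [d] makes the penalty function increase by [o(t)] at most along
    [zb + t d], for a sequence of steps [t] that realises the upper Dini
    derivative of [v_gamma]. Moving on from [zb + t d] by [t s h], for an arbitrary
    vector [h] and with [t] much smaller than [s], must therefore not decrease the
    penalty function at first order ([penalty_step]). Only constraints that are
    active and stationary along [d] contribute, which is where the two
    orthogonality conditions come from. The increment of [v_gamma] is bounded
    from below by [<xi, h>] for a regular subgradient [xi] at a nearby point, by a
    mean value theorem proved by minimisation with a quadratic penalty
    ([approx_mean_value], [cone_subgradient]). Letting [s] tend to 0, a cluster
    point [xi] of these subgradients lies in the directional limiting
    subdifferential of [v_gamma], and the slope of the penalty function along [h],
    computed with [xi], is nonnegative ([slope_subgradient]).

    The vectors [grad F + alpha (grad f - xi) + sum_i l_i grad c_i], with [xi] in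
    the convex hull of the limiting subgradients and with multipliers in [0, rho],
    supported on the active constraints, form a compact convex set: by
    Caratheodory's theorem combinations of a bounded number of points are enough
    for the hull, which makes it compact ([hull_convex], [hull_compact]). Every
    [h] has a nonnegative product with some element of this set, so the set
    contains 0 ([compact_convex_has0], [penalty_multipliers]). *)

(** * Euclidean geometry of the product space *)

Section EuclideanProduct.
Context {R : realType} {n m : nat}.
Local Notation E := ('rV[R]_n * 'rV[R]_m)%type.
Implicit Types (a b c z : E) (t : R).

Lemma dotDl k (a b c : 'rV[R]_k) : dot (a + b) c = dot a c + dot b c.
Proof. by rewrite /dot -big_split; apply: eq_bigr => i _; rewrite mxE mulrDl. Qed.

Lemma dotZl k t (a c : 'rV[R]_k) : dot (t *: a) c = t * dot a c.
Proof. by rewrite /dot big_distrr; apply: eq_bigr => i _; rewrite mxE -mulrA. Qed.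

Lemma dotC k (a b : 'rV[R]_k) : dot a b = dot b a.
Proof. by apply: eq_bigr => i _; rewrite mulrC. Qed.

Lemma dot_ge0 k (a : 'rV[R]_k) : 0 <= dot a a.
Proof. by apply: sumr_ge0 => i _; rewrite -expr2 sqr_ge0. Qed.

Lemma pdotC a b : pdot a b = pdot b a.
Proof. by rewrite /pdot !(dotC a.1, dotC a.2). Qed.

Lemma pdotDl a b c : pdot (a + b) c = pdot a c + pdot b c.
Proof. by rewrite /pdot !dotDl addrACA. Qed.

Lemma pdotZl t a c : pdot (t *: a) c = t * pdot a c.
Proof. by rewrite /pdot !dotZl mulrDr. Qed.

Lemma pdotNl a c : pdot (- a) c = - pdot a c.
Proof. by rewrite -scaleN1r pdotZl mulN1r. Qed.

Lemma pdotBl a b c : pdot (a - b) c = pdot a c - pdot b c.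
Proof. by rewrite pdotDl pdotNl. Qed.

Lemma pdotDr a b c : pdot c (a + b) = pdot c a + pdot c b.
Proof. by rewrite pdotC pdotDl !(pdotC _ c). Qed.

Lemma pdotZr t a c : pdot c (t *: a) = t * pdot c a.
Proof. by rewrite pdotC pdotZl pdotC. Qed.

Lemma pdotNr a c : pdot c (- a) = - pdot c a.
Proof. by rewrite pdotC pdotNl pdotC. Qed.

Lemma pdotBr a b c : pdot c (a - b) = pdot c a - pdot c b.
Proof. by rewrite pdotDr pdotNr. Qed.

Lemma pdot0l c : pdot 0 c = 0.
Proof. by rewrite -(scale0r c) pdotZl mul0r. Qed.

Lemma pdot0r c : pdot c 0 = 0.
Proof. by rewrite pdotC pdot0l. Qed.

Lemma pdot_suml (I : finType) (a_ : I -> E) c :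
  pdot (\sum_i a_ i) c = \sum_i pdot (a_ i) c.
Proof. by elim/big_rec2: _ => [|i y x _ <-]; rewrite ?pdot0l ?pdotDl. Qed.

Definition pdotE := (pdotDl, pdotDr, pdotBl, pdotBr, pdotZl, pdotZr, pdotNl,
  pdotNr).

Lemma pdot_ge0 a : 0 <= pdot a a.
Proof. by rewrite addr_ge0 ?dot_ge0. Qed.

Lemma penorm_ge0 a : 0 <= penorm a.
Proof. exact: sqrtr_ge0. Qed.

Lemma sqr_penorm a : penorm a ^+ 2 = pdot a a.
Proof. by rewrite sqr_sqrtr ?pdot_ge0. Qed.

(** The topology comes from the sup norm. This bound and the next one let
    convergence, compactness and differentiability be used in Euclidean terms. *)
Lemma norm_le_penorm a : `|a| <= penorm a.
Proof.
have sub k (b : 'rV[R]_k) : `|b| <= Num.sqrt (dot b b).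
  rewrite /Num.norm/= mx_normrE; apply: bigmax_le; first exact: sqrtr_ge0.
  move=> [i j] _ /=; rewrite ord1 -sqrtr_sqr ler_wsqrtr// /dot (bigD1 j)//=.
  by rewrite expr2 lerDl sumr_ge0// => l _; rewrite -expr2 sqr_ge0.
rewrite prod_normE/= ge_max; apply/andP; split; apply: (le_trans (sub _ _));
  by rewrite ler_wsqrtr// /pdot ?lerDl ?lerDr dot_ge0.
Qed.

Lemma penorm_le_norm a : penorm a <= (n + m)%:R * `|a|.
Proof.
have sub k (b : 'rV[R]_k) : dot b b <= k%:R * `|b| ^+ 2.
  rewrite -[k in k%:R]card_ord -sum1_card natr_sum big_distrl/= /dot.
  apply: ler_sum => i _; rewrite mul1r -expr2 -(real_normK (num_real (b 0 i))).
  rewrite lerXn2r ?nnegrE// [leRHS]/Num.norm/= mx_normrE.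
  by apply/bigmax_geP; right; exists (0, i).
rewrite -(@ger0_norm _ ((n + m)%:R * `|a|)) ?mulr_ge0// -sqrtr_sqr ler_wsqrtr//.
have [n1 n2] : `|a.1| <= `|a| /\ `|a.2| <= `|a|.
  by rewrite prod_normE/= !le_max !lexx ?orbT.
apply: (@le_trans _ _ ((n + m)%:R * `|a| ^+ 2)).
  rewrite natrD mulrDl lerD//; apply: (le_trans (sub _ _));
  by rewrite ler_wpM2l// lerXn2r ?nnegrE.
rewrite exprMn ler_wpM2r ?sqr_ge0// -natrX ler_nat.
by case: (n + m)%N => // k; rewrite leq_pmulr.
Qed.

Lemma penorm0 : penorm (0 : E) = 0.
Proof. by rewrite /penorm pdot0l sqrtr0. Qed.

Lemma penorm0_eq0 a : penorm a = 0 -> a = 0.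
Proof. by move=> a0; apply/eqP; rewrite -normr_le0 -a0 norm_le_penorm. Qed.

Lemma penormZ t a : penorm (t *: a) = `|t| * penorm a.
Proof.
by rewrite /penorm pdotZl pdotZr mulrA -expr2 sqrtrM ?sqr_ge0// sqrtr_sqr.
Qed.

Lemma penormN a : penorm (- a) = penorm a.
Proof. by rewrite -scaleN1r penormZ normrN1 mul1r. Qed.

Lemma penormB a b : penorm (a - b) = penorm (b - a).
Proof. by rewrite -penormN opprB. Qed.

Lemma pdot_cauchy a b : `|pdot a b| <= penorm a * penorm b.
Proof.
have [b0|b0] := eqVneq (penorm b) 0.
  by rewrite (penorm0_eq0 b0) pdot0r normr0 penorm0 mulr0.
have bb : 0 < pdot b b by rewrite -sqr_penorm exprn_gt0// lt0r b0 penorm_ge0.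
have := pdot_ge0 (pdot b b *: a - pdot a b *: b).
rewrite !pdotE (pdotC b a) => h.
have {}h : 0 <= pdot b b * (pdot b b * pdot a a - pdot a b ^+ 2) by nra.
rewrite pmulr_rge0// subr_ge0 in h.
rewrite -(ler_pXn2r (ltn0Sn 1)) ?nnegrE ?mulr_ge0 ?penorm_ge0//.
by rewrite real_normK ?num_real// exprMn !sqr_penorm mulrC.
Qed.

Lemma pdot_le a b : pdot a b <= penorm a * penorm b.
Proof. exact: le_trans (ler_norm _) (pdot_cauchy a b). Qed.

Lemma penormD a b : penorm (a + b) <= penorm a + penorm b.
Proof.
rewrite -(ler_pXn2r (ltn0Sn 1)) ?nnegrE ?addr_ge0 ?penorm_ge0//.
rewrite sqrrD !sqr_penorm !pdotE (pdotC b a).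
have := pdot_le a b; lra.
Qed.

Lemma penorm_distD a b c : penorm (a - c) <= penorm (a - b) + penorm (b - c).
Proof. by have := penormD (a - b) (b - c); rewrite subrKA. Qed.

Lemma penorm_distr a b : `|penorm a - penorm b| <= penorm (a - b).
Proof.
have := penormD (a - b) b; have := penormD (b - a) a; rewrite !subrK.
by rewrite (penormB b a) ler_norml => h1 h2; apply/andP; split; lra.
Qed.

Lemma nbhs_penorm_ball z r : 0 < r -> \forall w \near z, penorm (w - z) < r.
Proof.
move=> r0; have nr : 0 < (n + m).+1%:R^-1 * r by rewrite mulr_gt0 ?invr_gt0.
apply/nbhs_normP; exists ((n + m).+1%:R^-1 * r) => // w /=.
rewrite distrC ltr_pdivlMl// => h.
apply: (le_lt_trans (penorm_le_norm _)); apply: le_lt_trans h.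
by rewrite ler_wpM2r// ler_nat.
Qed.

Lemma penorm_continuous : continuous (fun a : E => penorm a).
Proof.
move=> a; apply/cvgrPdist_lt => e e0.
apply: filterS (nbhs_penorm_ball a e0) => b; apply: le_lt_trans.
by rewrite penormB; exact: penorm_distr.
Qed.

Lemma penorm_ball_compact z r : compact [set w : E | penorm (w - z) <= r].
Proof.
have cX : compact ([set x : 'rV[R]_n | `|x| <= penorm z + `|r|] `*`
                   [set y : 'rV[R]_m | `|y| <= penorm z + `|r|]).
  have cl k : compact [set x : 'rV[R]_k | `|x| <= penorm z + `|r|].
    apply: bounded_closed_compact.
      by exists (penorm z + `|r|); split; [exact: num_real|];
        move=> M lM x /le_trans; apply; exact: ltW.
    apply: (preimage_closed (f := (fun x : 'rV[R]_k => `|x|))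
      (D := [set y | y <= _])).
      by move=> x _; exact: norm_continuous.
    exact: closed_le.
  by apply: compact_setX; exact: cl.
apply: subclosed_compact cX _.
  apply: (preimage_closed (f := (fun w : E => penorm (w - z)))
    (D := [set y | y <= _])).
    move=> x _; apply: continuous_comp; last exact: penorm_continuous.
    by apply: cvgB; [exact: cvg_id|exact: cvg_cst].
  exact: closed_le.
move=> w /= wr; have : `|w| <= penorm z + `|r|.
  apply: (le_trans (norm_le_penorm _)).
  rewrite -(subrK z w) addrC (le_trans (penormD _ _))// lerD2l.
  by rewrite (le_trans wr)// ler_norm.
by rewrite prod_normE/= ge_max => /andP.
Qed.

End EuclideanProduct.

(** * Compact convex sets and Caratheodory's theorem *)

Section CompactConvex.
Context {R : realType} {n m : nat}.
Local Notation E := ('rV[R]_n * 'rV[R]_m)%type.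
Implicit Types (A B D : set E).

Definition segment_closed A := forall (x y : E) (t : R),
  A x -> A y -> 0 <= t -> t <= 1 -> A ((1 - t) *: x + t *: y).

Lemma convex_set_segment_closed A : @convex_set R E A -> segment_closed A.
Proof.
move=> cA x y t Ax Ay t0 t1.
have i0 : 0 <= 1 - t by rewrite subr_ge0.
have i1 : 1 - t <= 1 by rewrite lerBlDr lerDl.
have := cA x y (Itv01 i0 i1) (mem_set Ax) (mem_set Ay).
by rewrite /conv/= inE /unstable.onem subKr.
Qed.

Definition scalings (r : R) A : set E :=
  (fun x : R * E => x.1 *: x.2) @` (`[0, r] `*` A).

Definition minkowski_sum A B : set E :=
  (fun x : E * E => x.1 + x.2) @` (A `*` B).

Definition segments A B : set E :=
  (fun x : R * (E * E) => (1 - x.1) *: x.2.1 + x.1 *: x.2.2) @`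
    (`[0, 1] `*` (A `*` B)).

Lemma scalings_compact r A : compact A -> compact (scalings r A).
Proof.
move=> cA; apply: continuous_compact; last first.
  by apply: compact_setX => //; exact: segment_compact.
apply: continuous_subspaceT => x.
by apply: cvgZ; [exact: cvg_fst|exact: cvg_snd].
Qed.

Lemma minkowski_sum_compact A B :
  compact A -> compact B -> compact (minkowski_sum A B).
Proof.
move=> cA cB; apply: continuous_compact; last exact: compact_setX.
apply: continuous_subspaceT => x.
by apply: cvgD; [exact: cvg_fst|exact: cvg_snd].
Qed.

Lemma segments_compact A B : compact A -> compact B -> compact (segments A B).
Proof.
move=> cA cB; apply: continuous_compact; last first.
  by apply: compact_setX; [exact: segment_compact|exact: compact_setX].
apply: continuous_subspaceT => x; apply: cvgD; apply: cvgZ.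
- by apply: cvgB; [exact: cvg_cst|exact: cvg_fst].
- by apply: (cvg_comp snd fst); [exact: cvg_snd|exact: cvg_fst].
- exact: cvg_fst.
- by apply: (cvg_comp snd snd); [exact: cvg_snd|exact: cvg_snd].
Qed.

Lemma minkowski_sum_convex A B :
  segment_closed A -> segment_closed B -> segment_closed (minkowski_sum A B).
Proof.
move=> cA cB _ _ t [[a b] [/= Aa Bb] <-] [[a' b'] [/= Aa' Bb'] <-] t0 t1.
exists ((1 - t) *: a + t *: a', (1 - t) *: b + t *: b') => /=.
  by split; [exact: cA|exact: cB].
by rewrite !scalerDr addrACA.
Qed.

(** A mixture of [s *: a] and [s' *: a'] is a multiple of a mixture of [a] and [a']
    with rescaled weights; the rescaling breaks down only at the vector 0. *)
Lemma scalings_convex r A : segment_closed A -> segment_closed (scalings r A).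
Proof.
move=> cA _ _ t [[s a] [/= sr Aa] <-] [[s' a'] [/= sr' Aa'] <-] t0 t1.
move: sr sr'; rewrite !in_itv/= => /andP[s0 sr] /andP[s0' sr'].
have p0 : 0 <= (1 - t) * s by rewrite mulr_ge0// subr_ge0.
have q0 : 0 <= t * s' by rewrite mulr_ge0.
rewrite !scalerA.
have [z|z] := eqVneq ((1 - t) * s + t * s') 0.
  move/eqP: z; rewrite paddr_eq0// => /andP[/eqP -> /eqP ->].
  exists (0, a); first by split=> //=; rewrite in_itv/= lexx (le_trans s0).
  by rewrite /= !scale0r addr0.
exists ((1 - t) * s + t * s',
  (1 - t * s' / ((1 - t) * s + t * s')) *: a +
  (t * s' / ((1 - t) * s + t * s')) *: a').
  split => /=.
    rewrite in_itv/= addr_ge0//=; nra.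
  apply: cA => //; first by rewrite divr_ge0// addr_ge0.
  by rewrite ler_pdivrMr ?mul1r ?lerDr// lt0r z addr_ge0.
rewrite /= scalerDr !scalerA; congr (_ *: _ + _ *: _).
  by rewrite mulrBr mulr1 mulrCA mulfV// mulr1 addrK.
by rewrite mulrCA mulfV// mulr1.
Qed.

(** Separation of 0 from a compact convex set: a nonzero point [a0] of least norm
    satisfies [pdot a a0 > 0] on the whole set, which excludes [h = - a0]. *)
Lemma compact_convex_has0 A : A !=set0 -> compact A -> segment_closed A ->
  (forall h, exists2 a, A a & 0 <= pdot a h) -> A 0.
Proof.
move=> A0 cA vA hA.
have [a0 /set_mem Aa0 amin] : exists2 a, a \in A &
    forall b, b \in A -> penorm a <= penorm b.
  apply: compact_EVT_min => //; apply: continuous_subspaceT.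
  exact: penorm_continuous.
have [z|nz] := eqVneq (penorm a0) 0; first by rewrite -(penorm0_eq0 z).
exfalso; have [a Aa] := hA (- a0); rewrite pdotNr oppr_ge0 => aa0.
have N0 : 0 < pdot a0 a0 by rewrite -sqr_penorm exprn_gt0// lt0r nz penorm_ge0.
(* If [pdot a a0 <= 0], the point [(1 - t) a0 + t a] of the segment has a smaller
   norm than [a0] for this [t]. *)
set t := pdot a0 a0 / (pdot a0 a0 + pdot a a).
have S0 : 0 < pdot a0 a0 + pdot a a by rewrite ltr_pwDl// pdot_ge0.
have t0 : 0 < t by rewrite divr_gt0.
have t1 : t <= 1 by rewrite ler_pdivrMr// mul1r lerDl pdot_ge0.
have := amin _ (mem_set (vA _ _ t Aa0 Aa (ltW t0) t1)).
rewrite -(ler_pXn2r (ltn0Sn 1)) ?nnegrE ?penorm_ge0// !sqr_penorm.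
rewrite !pdotE (pdotC a0 a) => h.
have tS : t * (pdot a0 a0 + pdot a a) = pdot a0 a0 by rewrite divfK// gt_eqF.
have : t * (t * (pdot a0 a0 + pdot a a) - 2 * pdot a0 a0 +
            2 * (1 - t) * pdot a a0) >= 0 by nra.
rewrite pmulr_rge0// tS; nra.
Qed.

(** [hull D k] consists of the convex combinations of at most [k.+1] points of
    [D]; building it one segment at a time makes compactness immediate. *)
Fixpoint hull D k : set E := if k is k'.+1 then segments (hull D k') D else D.

Lemma hull_compact D k : compact D -> compact (hull D k).
Proof. by move=> cD; elim: k => //= k IH; exact: segments_compact. Qed.

Lemma hull_sub_convex D B k : segment_closed B -> D `<=` B -> hull D k `<=` B.
Proof.
move=> cB DB; elim: k => //= k IH _ [[t [x y]] [/= tI [Hx Dy]] <-].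
by move: tI; rewrite in_itv/= => /andP[t0 t1]; apply: cB; auto.
Qed.

Lemma hull0 D k : D !=set0 -> hull D k !=set0.
Proof.
move=> [x Dx]; elim: k => [|k [y IH]]; first by exists x.
by exists y; exists (0, (y, x)) => //=; rewrite ?in_itv/= ?lexx ?ler01 //;
  rewrite subr0 scale1r scale0r addr0.
Qed.

(** Weights and points are indexed by [nat], so that the same functions serve all
    numbers of points. *)
Definition convex_comb D k : set E := [set x |
  exists (w : nat -> R) (p : nat -> E),
  [/\ forall i, (i < k)%N -> 0 <= w i, forall i, (i < k)%N -> D (p i),
      \sum_(i < k) w i = 1 & x = \sum_(i < k) w i *: p i]].

Lemma hullE D k : hull D k = convex_comb D k.+1.
Proof.
apply/seteqP; split.
  elim: k => [x Dx|k IH _ [[t [x y]] [/= tI [/IH Hx Dy]] <-]] /=.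
    exists (fun=> 1), (fun=> x); split=> //; rewrite ?big_ord1 ?scale1r//.
  move: tI; rewrite in_itv/= => /andP[t0 t1].
  have [w [p [w0 Dp w1 ->]]] := Hx.
  exists (fun i => if (i < k.+1)%N then (1 - t) * w i else t),
         (fun i => if (i < k.+1)%N then p i else y); split.
  - move=> i ik; case: ifP => // /w0; apply: mulr_ge0; by rewrite subr_ge0.
  - by move=> i ik; case: ifP => // /Dp.
  - rewrite big_ord_recr/= ltnn -[RHS](subrK t); congr (_ + _).
    rewrite -[RHS]mulr1 -w1 big_distrr/=; apply: eq_bigr => i _.
    by rewrite ltn_ord.
  - rewrite [RHS]big_ord_recr/= ltnn; congr (_ + _).
    by rewrite scaler_sumr; apply: eq_bigr => i _; rewrite ltn_ord scalerA.
elim: k => [|k IH] _ [w [p [w0 Dp w1 ->]]].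
  by move: w1; rewrite !big_ord1 => ->; rewrite scale1r; exact: Dp.
move: w1; rewrite big_ord_recr/= => w1.
have wk0 : 0 <= \sum_(i < k.+1) w i.
  by apply: sumr_ge0 => i _; apply: w0; rewrite ltnS ltnW.
have [z|z] := eqVneq (w k.+1) 1.
  have /psumr_eq0P z0 : \sum_(i < k.+1) w i = 0 by move: w1; rewrite z; lra.
  rewrite big_ord_recr/= z scale1r big1 ?add0r; last first.
    move=> i _; rewrite z0 ?scale0r// => j _; apply: w0.
    by rewrite ltnS ltnW.
  have [y Hy] : hull D k !=set0 by apply: hull0; exists (p 0%N); exact: Dp.
  exists (1, (y, p k.+1)); last by rewrite /= subrr scale0r add0r scale1r.
  by split=> /=; [rewrite in_itv/= ler01 lexx|split=> //; exact: Dp].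
have u0 : 1 - w k.+1 != 0 by rewrite subr_eq0 eq_sym.
exists (w k.+1,
  (\sum_(i < k.+1) ((1 - w k.+1)^-1 * w i) *: p i, p k.+1)).
  split => /=.
    by rewrite in_itv/= w0//= -w1 lerDr.
  split; last exact: Dp.
  apply: IH; exists (fun i => (1 - w k.+1)^-1 * w i), p; split => //.
  - move=> i ik; rewrite mulr_ge0// ?invr_ge0 -?w1 ?addrK// w0//.
    exact: ltnW.
  - by move=> i ik; apply: Dp; exact: ltnW.
  - by rewrite -big_distrr/= -w1 addrK mulVf// -[X in X != _](addrK (w k.+1)) w1.
rewrite /= [RHS]big_ord_recr/=; congr (_ + _).
rewrite scaler_sumr; apply: eq_bigr => i _.
by rewrite scalerA mulrA mulfV// mul1r.
Qed.

(** Appending a coordinate 1 to each point turns affine dependence into linear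
    dependence in dimension [n + m + 1]. *)
Lemma affine_dependence N (p : 'I_N -> E) : (n + m + 1 < N)%N ->
  exists mu : 'I_N -> R,
    [/\ \sum_i mu i = 0, \sum_i mu i *: p i = 0 & exists i, 0 < mu i].
Proof.
move=> dN.
pose X : 'M[R]_(N, n + m + 1) :=
  row_mx (row_mx (\matrix_i (p i).1) (\matrix_i (p i).2)) (const_mx 1).
have : kermx X != 0.
  rewrite kermx_eq0 -row_leq_rank -ltnNge.
  exact: leq_ltn_trans (rank_leq_col _) dN.
case/rowV0Pn => mu /sub_kermxP muX mu0.
have mu1 : \sum_i mu 0 i = 0.
  have := congr1 (fun M => rsubmx M 0 0) muX.
  rewrite /X mul_mx_row row_mxKr !mxE => h; rewrite -[RHS]h.
  by apply: eq_bigr => i _; rewrite !mxE mulr1.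
have muL := congr1 lsubmx muX.
rewrite /X mul_mx_row row_mxKl in muL.
have mup : \sum_i mu 0 i *: p i = 0.
  apply/eqP; rewrite -pair_eqE /pair_eq/= !(big_morph fst (fun _ _ => erefl) erefl)
    !(big_morph snd (fun _ _ => erefl) erefl); apply/andP; split; apply/eqP.
    have := congr1 lsubmx muL.
    rewrite mul_mx_row row_mxKl !linear0 => h; rewrite -[RHS]h.
    apply/rowP => j; rewrite summxE mxE; apply: eq_bigr => i _.
    by rewrite !mxE.
  have := congr1 rsubmx muL.
  rewrite mul_mx_row row_mxKr !linear0 => h; rewrite -[RHS]h.
  apply/rowP => j; rewrite summxE mxE; apply: eq_bigr => i _.
  by rewrite !mxE.
exists (mu 0); split => //.
apply: contrapT => /forallNP np.
move/negP: mu0; apply; apply/eqP/rowP => i; rewrite mxE.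
have /psumr_eq0P z : \sum_i - mu 0 i = 0 by rewrite sumrN mu1 oppr0.
apply/eqP; rewrite -oppr_eq0 z// => j _.
by rewrite oppr_ge0 leNgt; apply/negP/np.
Qed.

Lemma sum_skip (V : nmodType) N (F : nat -> V) (j : 'I_N.+1) : F j = 0 ->
  \sum_(i < N.+1) F i = \sum_(i < N) F (if i == j :> nat then N else i).
Proof.
move=> Fj; rewrite big_ord_recr/=.
have [jN|jN] := eqVneq (j : nat) N.
  have -> : F N = 0 by rewrite -jN.
  rewrite addr0; apply: eq_bigr => i _.
  by rewrite jN ltn_eqF.
have jlt : (j < N)%N by rewrite ltn_neqAle jN /= -ltnS ltn_ord.
rewrite (bigD1 (Ordinal jlt))//= Fj add0r [RHS](bigD1 (Ordinal jlt))//= eqxx.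
rewrite addrC; congr (_ + _); apply: eq_bigr => i; rewrite -val_eqE/= => /negbTE.
by move=> ->.
Qed.

Lemma convex_comb_reduce D N : (n + m + 1 <= N)%N ->
  convex_comb D N.+1 `<=` convex_comb D N.
Proof.
move=> dN _ [w [p [w0 Dp w1 ->]]].
have [mu [mu1 mup [i0 mui0]]] := @affine_dependence N.+1 (fun i => p i) dN.
(* The largest multiple of [mu] that keeps the weights [w - c * mu]
   nonnegative makes one of them vanish. *)
have [j muj jmin] : exists2 j, 0 < mu j &
    forall i, 0 < mu i -> w j / mu j <= w i / mu i.
  by case: (@arg_minP _ _ _ i0 (fun i => 0 < mu i) (fun i => w i / mu i) mui0)
    => j; exists j.
set c := w j / mu j.
have c0 : 0 <= c by rewrite divr_ge0 ?(ltW muj) ?w0.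
pose w' i := w i - c * (if insub i is Some k then mu k else 0).
have w'E (i : 'I_N.+1) : w' i = w i - c * mu i.
  by rewrite /w'; case: insubP => [k _ /val_inj ->//|]; rewrite ltn_ord.
have w'j : w' j = 0 by rewrite w'E /c divfK ?gt_eqF// subrr.
have w'0 i : (i < N.+1)%N -> 0 <= w' i.
  move=> iN; rewrite (w'E (Ordinal iN))/= subr_ge0.
  have [m0|m0] := ltP 0 (mu (Ordinal iN)).
    by rewrite -ler_pdivlMr//; exact: (jmin (Ordinal iN)).
  by apply: (@le_trans _ _ 0); [rewrite mulr_ge0_le0|exact: w0].
(* The index [j] is deleted by moving the last point into its place. *)
pose sk i := if i == j :> nat then N else i.
have skN i : (i < N)%N -> (sk i < N.+1)%N.
  by rewrite /sk; case: ifP => // _ /ltnW.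
exists (w' \o sk), (p \o sk); split=> /=.
- by move=> i /skN; exact: w'0.
- by move=> i /skN; exact: Dp.
- rewrite -(@sum_skip _ N w' j)//.
  transitivity (\sum_(i < N.+1) w i - c * \sum_i mu i).
    by rewrite big_distrr/= -sumrB; apply: eq_bigr => i _; rewrite w'E.
  by rewrite w1 mu1 mulr0 subr0.
- rewrite -(@sum_skip _ N (fun i => w' i *: p i) j); last by rewrite w'j scale0r.
  transitivity (\sum_(i < N.+1) w i *: p i - c *: \sum_i mu i *: p i).
    by rewrite mup scaler0 subr0.
  rewrite scaler_sumr -sumrB.
  by apply: eq_bigr => i _; rewrite w'E scalerBl scalerA.
Qed.

Lemma convex_comb_caratheodory D N :
  convex_comb D (n + m + 1 + N) `<=` convex_comb D (n + m + 1).
Proof.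
elim: N => [|N IH]; first by rewrite addn0.
by rewrite addnS => x /convex_comb_reduce-/(_ (leq_addr _ _)) /IH.
Qed.

(** Mixing two combinations of [n + m + 1] points gives one of twice as many
    points, which Caratheodory's theorem brings back to [n + m + 1]. *)
Lemma hull_convex D : segment_closed (hull D (n + m)).
Proof.
rewrite hullE -addn1 => _ _ t [w [p [w0 Dp w1 ->]]] [w' [p' [w0' Dp' w1' ->]]] t0 t1.
set N := (n + m + 1)%N in w0 Dp w1 w0' Dp' w1' *.
apply: (@convex_comb_caratheodory _ N).
exists (fun i => if (i < N)%N then (1 - t) * w i else t * w' (i - N)%N),
  (fun i => if (i < N)%N then p i else p' (i - N)%N); split.
- move=> i iN; case: ifP => [/w0|/negbT]; first by apply: mulr_ge0; rewrite subr_ge0.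
  by rewrite -leqNgt => Ni; rewrite mulr_ge0// w0'// ltn_subLR.
- move=> i iN; case: ifP => [/Dp//|/negbT].
  by rewrite -leqNgt => Ni; apply: Dp'; rewrite ltn_subLR.
- rewrite big_split_ord/=.
  under eq_bigr do rewrite ltn_ord.
  under [X in _ + X]eq_bigr do rewrite ltnNge leq_addr/= addKn.
  by rewrite -!big_distrr/= w1 w1' !mulr1 subrK.
- rewrite [RHS]big_split_ord/= !scaler_sumr; congr (_ + _);
    apply: eq_bigr => i _; first by rewrite ltn_ord scalerA.
  by rewrite ltnNge leq_addr/= addKn scalerA.
Qed.

Lemma sub_hull D k : D `<=` hull D k.
Proof.
move=> x Dx; elim: k => //= k IH.
exists (0, (x, x)); first by split=> //=; rewrite in_itv/= lexx ler01.
by rewrite /= subr0 scale1r scale0r addr0.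
Qed.

(** Combinations [\sum_i l i *: a i] with [0 <= l i <= b i], built one summand at
    a time for the same reason as [hull]. *)
Fixpoint zonotope (I : eqType) (b : I -> R) (a : I -> E) (s : seq I) : set E :=
  if s is i :: s' then
    minkowski_sum (scalings (b i) [set a i]) (zonotope b a s')
  else [set 0].

Lemma set1_convex (a : E) : segment_closed [set a].
Proof. by move=> _ _ t -> -> _ _; rewrite /= -scalerDl subrK scale1r. Qed.

Lemma zonotope_compact (I : eqType) (b : I -> R) a s : compact (zonotope b a s).
Proof.
elim: s => [|i s IH] /=; first exact: compact_set1.
by apply: minkowski_sum_compact IH; apply: scalings_compact; exact: compact_set1.
Qed.

Lemma zonotope_convex (I : eqType) (b : I -> R) a s :
  segment_closed (zonotope b a s).
Proof.
elim: s => [|i s IH] /=; first exact: set1_convex.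
by apply: minkowski_sum_convex IH; apply: scalings_convex; exact: set1_convex.
Qed.

Lemma zonotopeE (I : eqType) (b : I -> R) a s x : (forall i, 0 <= b i) ->
  uniq s -> zonotope b a s x <->
  exists2 l : I -> R, forall i, 0 <= l i <= b i & x = \sum_(i <- s) l i *: a i.
Proof.
move=> b0; elim: s x => [|i s IH] x /=.
  move=> _; split=> [->|[l _ ->]]; rewrite ?big_nil//.
  by exists (fun=> 0); rewrite ?big_nil// => i; rewrite lexx b0.
move=> /andP[ins us]; split.
  move=> [[z y] [[[t w] [/= tI ->] /= <-] /= /(IH _ us)[l lb ->]] <-] /=.
  exists (fun j => if j == i then t else l j).
    by move=> j; case: eqP => // ->; move: tI; rewrite in_itv.
  rewrite big_cons eqxx /=; congr (_ + _); apply: eq_big_seq => j js.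
  by case: eqP => // ji; move: ins; rewrite -ji js.
move=> [l lb ->]; rewrite big_cons.
exists (l i *: a i, \sum_(j <- s) l j *: a j) => //; split => /=.
  by exists (l i, a i) => //; split=> //=; rewrite in_itv/= lb.
by apply/(IH _ us); exists l.
Qed.

End CompactConvex.

(** * An approximate mean value theorem for regular subgradients *)

Section MeanValue.
Context {R : realType} {n m : nat}.
Local Notation E := ('rV[R]_n * 'rV[R]_m)%type.
Implicit Types (psi : E -> \bar R) (a k w z : E).

Lemma lipschitz_within (A : set E) (v : E -> R) (L : R) : 0 < L ->
  (forall w w', A w -> A w' -> `|v w - v w'| <= L * penorm (w - w')) ->
  forall w, A w -> v @ within A (nbhs w) --> v w.
Proof.
move=> L0 Lv w Aw; apply/cvgrPdist_lt => e e0.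
have eL : 0 < e / L by rewrite divr_gt0.
rewrite near_withinE; apply: filterS (nbhs_penorm_ball w eL) => w' + Aw'.
rewrite ltr_pdivlMr// => h; apply: (le_lt_trans (Lv _ _ Aw Aw')).
by rewrite mulrC penormB.
Qed.

(** A point [w] where [psi + K |. - p|^2] has a local minimum: the first-order part
    of [- K |. - p|^2] at [w] supports [psi] from below up to a quadratic error. *)
Lemma prox_reg_subdiff psi w p (K : R) : 0 <= K -> psi w \is a fin_num ->
  (\forall z \near w, psi z \is a fin_num /\
    fine (psi w) + K * pdot (w - p) (w - p) <=
      fine (psi z) + K * pdot (z - p) (z - p)) ->
  reg_subdiff psi w ((- (2 * K)) *: (w - p)).
Proof.
move=> K0 fw mw; split=> // e e0.
have eK : 0 < e / (K + 1) by rewrite divr_gt0// ltr_wpDl.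
apply: filterS (filterI mw (nbhs_penorm_ball w eK)) => z [[fz mz]].
rewrite ltr_pdivlMr ?ltr_wpDl// => zw.
rewrite -(fineK fw) -(fineK fz) -EFinD lee_fin.
have zp : z - p = (w - p) + (z - w) by rewrite [RHS]addrC subrKA.
move: mz; rewrite zp pdotZl.
move: (w - p) (z - w) zw => q d zw.
have dd : K * pdot d d <= e * penorm d.
  rewrite -sqr_penorm expr2 mulrA ler_wpM2r ?penorm_ge0//.
  by have := penorm_ge0 d; nra.
rewrite !pdotE (pdotC d q); move: dd; set dd := pdot d d; set qd := pdot q d.
nra.
Qed.

(** Minimising [psi w - c * s + K * |w - a - s *: k|^2] over the points [w] of
    the ball and [s] in [0, 1]. For large [K] the minimiser [(w, s)] stays close
    to the segment, and [s = 1] is excluded because [psi] increases by more than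
    [c] along it. Minimality in [w] makes [xi = -2K (w - a - s *: k)] a regular
    subgradient at [w], and minimality in [s] gives [c <= <xi, k>]. *)
Lemma approx_mean_value psi z (r L : R) a k (c : R) : 0 < L ->
  (forall w, penorm (w - z) <= r -> psi w \is a fin_num) ->
  (forall w w', penorm (w - z) <= r -> penorm (w' - z) <= r ->
    `|fine (psi w) - fine (psi w')| <= L * penorm (w - w')) ->
  penorm (a - z) < r -> penorm (a + k - z) < r ->
  c < fine (psi (a + k)) - fine (psi a) ->
  exists w xi, [/\ penorm (w - z) < r, reg_subdiff psi w xi,
    penorm xi <= 2 * L & c <= pdot xi k].
Proof.
move=> L0 fpsi Lpsi ar akr cpsi.
set B := [set w : E | penorm (w - z) <= r].
set v := fun w => fine (psi w).
set r1 := Num.max (penorm (a - z)) (penorm (a + k - z)).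
have r1r : r1 < r by rewrite gt_max ar.
set D := v (a + k) - v a - c.
have D0 : 0 < D by rewrite subr_gt0.
(* [KL1] keeps the minimiser inside the ball and [KL2] excludes [s = 1]. *)
set K := L / (r - r1) + L ^+ 2 / D + 1.
have KL1 : L < K * (r - r1).
  rewrite -ltr_pdivrMr ?subr_gt0// /K -addrA ltrDl ltr_wpDl//.
  by rewrite divr_ge0 ?sqr_ge0// ltW.
have KL2 : L ^+ 2 < K * D.
  rewrite -ltr_pdivrMr// /K addrAC ltrDr ltr_wpDl//.
  by rewrite divr_ge0 ?subr_ge0// ltW.
have K0 : 0 < K.
  by rewrite /K ltr_wpDl// addr_ge0// divr_ge0 ?sqr_ge0 ?subr_ge0// ltW.
pose pt (s : R) := a + s *: k.
have ptB s : 0 <= s -> s <= 1 -> penorm (pt s - z) <= r1.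
  move=> s0 s1.
  have -> : pt s - z = (1 - s) *: (a - z) + s *: (a + k - z).
    rewrite (addrAC a k) (scalerDr s (a - z)) addrA -scalerDl subrK scale1r.
    exact: addrAC.
  apply: (le_trans (penormD _ _)); rewrite !penormZ !ger0_norm ?subr_ge0//.
  have h1 : penorm (a - z) <= r1 by rewrite le_max lexx.
  have h2 : penorm (a + k - z) <= r1 by rewrite le_max lexx orbT.
  nra.
pose phi (x : R * E) := v x.2 - c * x.1 +
  K * penorm (x.2 - pt x.1) ^+ 2.
have [[s w] /set_mem[/= sI wB] mphi] : exists2 x, x \in `[0, 1] `*` B &
    forall y, y \in `[0, 1] `*` B -> phi x <= phi y.
  apply: compact_EVT_min.
  - exists (0, a); split => /=; first by rewrite in_itv/= lexx ler01.
    exact: ltW.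
  - by apply: compact_setX; [exact: segment_compact|exact: penorm_ball_compact].
  - apply/subspace_continuousP => x [/= xI xB].
    apply: cvgD; first apply: cvgB.
    + apply: (@cvg_comp _ _ _ snd v _ (within B (nbhs x.2))); last first.
        exact: (lipschitz_within L0 Lpsi).
      move=> W BW; have BW' : \forall y \near x, B y.2 -> W y.2.
        exact: (cvg_snd (F := nbhs x.1) (G := nbhs x.2)) BW.
      rewrite /= near_simpl near_withinE.
      by apply: filterS BW' => y /= + [_ yB]; exact.
    + by apply: cvg_within_filter; apply: cvgMr; exact: cvg_fst.
    + apply: cvg_within_filter; apply: cvgMr.
      have ptc : penorm (y.2 - pt y.1) @[y --> x] --> penorm (x.2 - pt x.1).
        apply: (@cvg_comp _ _ _ (fun y : R * E => y.2 - pt y.1) _ _ _ _ _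
                  (@penorm_continuous _ _ _ _)).
        apply: cvgB; first exact: cvg_snd.
        apply: cvgD; first exact: cvg_cst.
        by apply: cvgZr_tmp; exact: cvg_fst.
      exact: (cvgM ptc ptc).
move: sI; rewrite in_itv/= => /andP[s0 s1].
set p := pt s; set N := penorm (w - p).
have N0 : 0 <= N := penorm_ge0 _.
have pB : penorm (p - z) <= r by rewrite (le_trans (ptB _ s0 s1))// ltW.
have KN : K * N <= L.
  have sp : (s, p) \in `[0, 1] `*` B by rewrite inE /= in_itv/= s0 s1.
  have := mphi _ sp.
  rewrite /phi/= subrr penorm0 -/p -/N expr0n mulr0 addr0 => h.
  have := le_trans (ler_norm _) (Lpsi _ _ pB wB).
  rewrite penormB -/N -/(v p) -/(v w) => h'.
  have [->|nz] := eqVneq N 0; first by rewrite mulr0 ltW.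
  have : K * N * N <= L * N by nra.
  by rewrite ler_pM2r// lt0r nz.
have wr : penorm (w - z) < r.
  apply: (le_lt_trans (penorm_distD _ p _)); have := ptB _ s0 s1.
  by rewrite -/p -/N; nra.
have s1' : s < 1.
  rewrite lt_neqAle s1 andbT; apply/negP => /eqP s1E.
  have ak : p = a + k by rewrite /p /pt s1E scale1r.
  have p0 : pt 0 = a by rewrite /pt scale0r addr0.
  have sp : ((0 : R), a) \in `[0, 1] `*` B.
    by rewrite inE /= in_itv/= lexx ler01; split=> //; exact: ltW.
  have := mphi _ sp.
  rewrite /phi/= -/p -/N p0 subrr penorm0 expr0n !mulr0 addr0 subr0.
  rewrite s1E => h.
  have := le_trans (ler_norm _) (Lpsi _ _ pB wB).
  rewrite penormB -/N -/(v p) -/(v w) ak => h'.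
  have : D <= L * N by rewrite /D; nra.
  by nra.
exists w, (- (2 * K) *: (w - p)); split => //.
- apply: prox_reg_subdiff; [exact: ltW|exact: fpsi|].
  have rw : 0 < r - penorm (w - z) by rewrite subr_gt0.
  apply: filterS (nbhs_penorm_ball w rw) => w' ww'.
  have wB' : penorm (w' - z) <= r.
    apply: (le_trans (penorm_distD _ w _)); lra.
  split; first exact: fpsi.
  have sw' : (s, w') \in `[0, 1] `*` B by rewrite inE /= in_itv/= s0 s1.
  have := mphi _ sw'; rewrite /phi/= -/p -!sqr_penorm -/(v w) -/(v w') => h.
  by rewrite -(lerD2r (- (c * s))) addrAC [leRHS]addrAC.
- by rewrite penormZ normrN ger0_norm ?mulr_ge0 ?(ltW K0)// -/N; lra.
have h e : 0 < e -> e <= 1 - s ->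
    c <= pdot (- (2 * K) *: (w - p)) k + e * (K * pdot k k).
  move=> e0 es.
  have sp : (s + e, w) \in `[0, 1] `*` B.
    by rewrite inE /= in_itv/=; split => //; apply/andP; split; lra.
  have := mphi _ sp; rewrite /phi/= -/p.
  have -> : w - pt (s + e) = (w - p) - e *: k.
    by rewrite /p /pt scalerDl addrA opprD addrA.
  rewrite !sqr_penorm; move: (w - p) => q.
  rewrite !pdotE (pdotC k q) => {}h.
  rewrite -(ler_pM2l e0); nra.
rewrite leNgt; apply/negP => lt.
pose G := c - pdot (- (2 * K) *: (w - p)) k; have G0 : 0 < G by rewrite subr_gt0.
have kk : 0 < K * pdot k k + 1 by rewrite ltr_wpDl// mulr_ge0 ?pdot_ge0 ?ltW.
set e := Num.min (1 - s) (G / 2 / (K * pdot k k + 1)).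
have e0 : 0 < e by rewrite lt_min subr_gt0 s1'/= !divr_gt0.
have e1 : e <= 1 - s by rewrite ge_min lexx.
have e2 : e * (K * pdot k k + 1) <= G / 2.
  by rewrite -ler_pdivlMr// ge_min lexx orbT.
have := h e e0 e1; rewrite -lerBlDl -/G; nra.
Qed.

End MeanValue.

(** * Directional neighborhoods and directional limiting subgradients *)

Section Directional.
Context {R : realType} {n m : nat}.
Local Notation E := ('rV[R]_n * 'rV[R]_m)%type.
Implicit Types (psi : E -> \bar R) (z zb d h w xi : E).

Lemma dir_nbhd0 (eps del : R) d : 0 < eps -> dir_nbhd eps del d 0.
Proof.
by move=> e0; split; rewrite !penorm0 ?scaler0 ?scale0r ?subr0 ?penorm0 ?mulr0
  ?mul0r.
Qed.

(** Separates the length of the step from its direction. The radius is chosen by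
    cases because the angular condition is void when [d = 0]. *)
Lemma dir_nbhd_cone (eps del : R) d : 0 < eps -> 0 < del ->
  exists2 r : R, 0 < r & forall t d', 0 < t -> t <= r -> penorm (d' - d) <= r ->
    dir_nbhd eps del d (t *: d').
Proof.
move=> e0 l0; have d0 := penorm_ge0 d.
pose r1 := if penorm d == 0 then 1
           else Num.min (penorm d / 2) (del * penorm d / 4).
have r10 : 0 < r1.
  rewrite /r1; case: eqVneq => // nz.
  by rewrite lt_min !divr_gt0// ?mulr_gt0// lt0r nz.
pose r := Num.min (Num.min 1 (eps / (2 * (penorm d + 1)))) r1.
have r0 : 0 < r by rewrite !lt_min ltr01 r10 divr_gt0// mulr_gt0// ltr_wpDl.
have rle1 : r <= 1 by rewrite !ge_min lexx.
have rle2 : r * (2 * (penorm d + 1)) <= eps.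
  rewrite -ler_pdivlMr ?mulr_gt0// ?ltr_wpDl//.
  by rewrite ge_min; apply/orP; left; rewrite ge_min lexx orbT.
have rle3 : r <= r1 by rewrite ge_min lexx orbT.
exists r => // t d' t0 tr dr; have d0' := penorm_ge0 d'.
have dd' : penorm d' <= penorm d + r.
  by have := penormD (d' - d) d; rewrite subrK; lra.
have dd'' : penorm d <= penorm d' + r.
  by have := penormD (d - d') d'; rewrite subrK penormB; lra.
split; rewrite penormZ gtr0_norm//.
  have : t * penorm d' <= r * (penorm d + r) by rewrite ler_pM// ltW.
  nra.
rewrite scalerA mulrC -scalerA -(scalerA t) -scalerBr penormZ gtr0_norm//.
rewrite mulrCA -mulrA ler_wpM2l ?(ltW t0)//.
have -> : penorm d *: d' - penorm d' *: d =
    penorm d *: (d' - d) + (penorm d - penorm d') *: d.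
  by rewrite scalerBr scalerBl addrA subrK.
apply: (le_trans (penormD _ _)); rewrite !penormZ ger0_norm//.
have hd : `|penorm d - penorm d'| <= r.
  by apply: (le_trans (penorm_distr _ _)); rewrite penormB.
move: rle3; rewrite /r1; case: eqVneq => [->|nz]; first by rewrite !(mul0r,mulr0) addr0.
rewrite le_min => /andP[r2 r4]; have d1 : 0 < penorm d by rewrite lt0r nz.
have : penorm d * penorm (d' - d) + `|penorm d - penorm d'| * penorm d
    <= (2 * r) * penorm d by nra.
move/le_trans; apply; rewrite ler_wpM2r//.
nra.
Qed.

(** Directional Lipschitz continuity, written for steps [t] in directions [d'] so
    that the estimates along [zb + t *: d'] can be used without unfolding the
    directional neighborhood. *)
Definition cone_lipschitz psi zb d (r L : R) : Prop :=
  [/\ 0 < r /\ 0 < L, psi zb \is a fin_num,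
    forall t d', 0 < t -> t <= r -> penorm (d' - d) <= r ->
      psi (zb + t *: d') \is a fin_num,
    forall t d' d'', 0 < t -> t <= r -> penorm (d' - d) <= r ->
      penorm (d'' - d) <= r ->
      `|fine (psi (zb + t *: d')) - fine (psi (zb + t *: d''))|
        <= L * (t * penorm (d' - d'')) &
    forall t d', 0 < t -> t <= r -> penorm (d' - d) <= r ->
      `|fine (psi (zb + t *: d')) - fine (psi zb)| <= L * (t * penorm d')].

Lemma dir_lipschitz_cone psi zb d : dir_lipschitz psi zb d ->
  exists r L, cone_lipschitz psi zb d r L.
Proof.
move=> [eps [del [L [e0 l0 fpsi Lpsi]]]].
have [r r0 hr] := dir_nbhd_cone d e0 l0.
have zbV : dir_nbhd eps del d (zb - zb) by rewrite subrr; exact: dir_nbhd0.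
have tV t d' : 0 < t -> t <= r -> penorm (d' - d) <= r ->
    dir_nbhd eps del d (zb + t *: d' - zb).
  by move=> t0 tr dr; rewrite addrAC subrr add0r; exact: hr.
have LL x : 0 <= x -> L * x <= (`|L| + 1) * x.
  by move=> x0; rewrite ler_wpM2r// (le_trans (ler_norm _))// lerDl.
exists r, (`|L| + 1); split.
- by split=> //; rewrite ltr_wpDl.
- exact: fpsi.
- by move=> t d' t0 tr dr; apply/fpsi/tV.
- move=> t d' d'' t0 tr dr dr'.
  apply: le_trans (Lpsi _ _ (tV _ _ t0 tr dr) (tV _ _ t0 tr dr')) _.
  rewrite opprD addrACA subrr add0r -scalerBr penormZ gtr0_norm// LL//.
  by rewrite mulr_ge0 ?penorm_ge0 ?ltW.
- move=> t d' t0 tr dr.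
  apply: le_trans (Lpsi _ _ (tV _ _ t0 tr dr) zbV) _.
  rewrite addrAC subrr add0r penormZ gtr0_norm// LL//.
  by rewrite mulr_ge0 ?penorm_ge0 ?ltW.
Qed.

(** The mean value theorem between [zb + t *: d] and [zb + t *: (d + s *: h)],
    inside the ball of radius [t * s * (|h| + 1)], which the cone contains. *)
Lemma cone_subgradient psi zb d (r L : R) h (t s : R) :
  cone_lipschitz psi zb d r L ->
  0 < t -> t <= r -> 0 < s -> s * (penorm h + 1) <= r ->
  exists d' xi, [/\ penorm (d' - d) < s * (penorm h + 1),
    reg_subdiff psi (zb + t *: d') xi, penorm xi <= 2 * L &
    t * s * pdot xi h - t * s * s <=
      fine (psi (zb + t *: (d + s *: h))) - fine (psi (zb + t *: d))].
Proof.
move=> [[r0 L0] _ fpsi Lpsi _] t0 tr s0 sr.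
have h0 := penorm_ge0 h.
have ts0 : 0 < t * s by rewrite mulr_gt0.
set z := zb + t *: d; set a := zb + t *: (d + s *: h).
have wE w : w = zb + t *: (d + t^-1 *: (w - z)).
  rewrite scalerDr scalerA mulfV ?gt_eqF// scale1r addrA -/z addrC.
  by rewrite subrK.
have wD w rr : penorm (w - z) <= t * rr ->
    penorm (d + t^-1 *: (w - z) - d) <= rr.
  rewrite (addrC d) addrK penormZ gtr0_norm ?invr_gt0// => wr.
  by rewrite ler_pdivrMl.
have wr w : penorm (w - z) <= t * (s * (penorm h + 1)) ->
    penorm (d + t^-1 *: (w - z) - d) <= r.
  by move/wD => h'; apply: le_trans h' sr.
have ak : a + (- (t * s)) *: h = z.
  by rewrite /a /z scalerDr scalerA addrA scaleNr addrK.
have [w [xi [w1 w2 w3 w4]]] : exists w xi,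
    [/\ penorm (w - z) < t * (s * (penorm h + 1)), reg_subdiff psi w xi,
      penorm xi <= 2 * L &
      fine (psi z) - fine (psi a) - t * s * s <= pdot xi (- (t * s) *: h)].
  apply: (approx_mean_value (a := a) (L := L)) => //.
  - by move=> w /wr w1; rewrite (wE w); exact: fpsi.
  - move=> w w' /wr w1 /wr w2; rewrite {1}(wE w) {1}(wE w').
    apply: le_trans (Lpsi _ _ _ t0 tr w1 w2) _.
    rewrite (addrC d) addrKA -scalerBr penormZ gtr0_norm ?invr_gt0//.
    by rewrite mulVKf ?gt_eqF// opprB addrA subrK.
  - rewrite /a /z opprD addrACA subrr add0r -scalerBr (addrC d) addrK scalerA.
    by rewrite penormZ gtr0_norm// mulrA ltr_pM2l// ltrDl.
  - by rewrite ak subrr penorm0 !mulr_gt0// ltr_wpDl.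
  - by rewrite ak ltrBlDr ltrDl mulr_gt0.
exists (d + t^-1 *: (w - z)), xi; split=> //.
- rewrite (addrC d) addrK penormZ gtr0_norm ?invr_gt0//.
  by rewrite ltr_pdivrMl.
- by rewrite -wE.
- move: w4; rewrite pdotZr; lra.
Qed.

(** Bounded limits of regular subgradients in direction [d], described by
    approximation and not by sequences so that closedness is immediate. *)
Definition bounded_dir_subgrads psi zb d (C : R) : set E :=
  [set xi | penorm xi <= C /\ forall e, 0 < e -> exists t d' xi',
    [/\ 0 < t < e, penorm (d' - d) < e, penorm (xi' - xi) < e &
      reg_subdiff psi (zb + t *: d') xi']].

Lemma bounded_dir_subgrads_compact psi zb d C :
  compact (bounded_dir_subgrads psi zb d C).
Proof.
apply: subclosed_compact (@penorm_ball_compact R n m 0 C) _; last first.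
  by move=> xi [xiC _] /=; rewrite subr0.
move=> xi cl; split.
  apply/ler_addgt0Pr => e e0.
  have [xi' [[xi'C _] /= h]] := cl _ (nbhs_penorm_ball xi e0).
  have := penormD (xi - xi') xi'; rewrite subrK penormB; lra.
move=> e e0; have e20 : 0 < e / 2 by rewrite divr_gt0.
have [xi1 [[_ /(_ _ e20)[t [d' [xi' [t0 d'd xi'1 sub]]]]] /= h]] :=
  cl _ (nbhs_penorm_ball xi e20).
exists t, d', xi'; split=> //; first by move: t0 => /andP[? ?]; lra.
  by lra.
by have := penorm_distD xi' xi1 xi; lra.
Qed.

Lemma cvg_penorm (x : nat -> E) l :
  (forall k, penorm (x k - l) < k.+1%:R^-1) -> x k @[k --> \oo] --> l.
Proof.
move=> xl; apply/cvgrPdist_lt => e e0.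
near=> k; rewrite distrC (le_lt_trans (norm_le_penorm _))//.
apply: (lt_trans (xl k)); near: k.
exact: near_infty_natSinv_lt (PosNum e0).
Unshelve. all: by end_near. Qed.

Lemma bounded_dir_subgrads_sub psi zb d r L C : cone_lipschitz psi zb d r L ->
  bounded_dir_subgrads psi zb d C `<=` dir_lim_subdiff psi zb d.
Proof.
move=> [[r0 L0] fzb fpsi _ Lpsi] xi [_ xiP].
have /choice[s sP] : forall k : nat, exists x : R * E * E,
    [/\ 0 < x.1.1 < k.+1%:R^-1, penorm (x.1.2 - d) < k.+1%:R^-1,
      penorm (x.2 - xi) < k.+1%:R^-1 &
      reg_subdiff psi (zb + x.1.1 *: x.1.2) x.2].
  move=> k; have k0 : 0 < k.+1%:R^-1 :> R by rewrite invr_gt0.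
  by have [t [d' [xi' h]]] := xiP _ k0; exists (t, d', xi').
have t0 : (s k).1.1 @[k --> \oo] --> (0 : R).
  apply/cvgrPdist_lt => e e0; near=> k.
  have [/andP[? ?] _ _ _] := sP k.
  rewrite sub0r normrN gtr0_norm//.
  apply: (@lt_trans _ _ k.+1%:R^-1) => //; near: k.
  exact: near_infty_natSinv_lt (PosNum e0).
have dd : (s k).1.2 @[k --> \oo] --> d by apply: cvg_penorm => k; have [] := sP k.
exists (fun k => (s k).1.1), (fun k => (s k).1.2), (fun k => (s k).2); split=> //.
- by move=> k; have [/andP[]] := sP k.
- have cone : \forall k \near \oo,
      (s k).1.1 <= r /\ penorm ((s k).1.2 - d) <= r.
    near=> k; have [/andP[_ ?] ? _ _] := sP k.
    have kr : k.+1%:R^-1 < r by near: k; exact: near_infty_natSinv_lt (PosNum r0).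
    by split; apply: ltW; apply: lt_trans kr.
  rewrite -(fineK fzb); apply/fine_cvgP; split.
    apply: filterS cone => k [? ?]; apply: fpsi => //.
    by have [/andP[]] := sP k.
  apply/cvgrPdist_lt => e e0.
  have e'0 : 0 < e / (L * (penorm d + r)).
    by rewrite divr_gt0// mulr_gt0// ltr_wpDl// penorm_ge0.
  near=> k; have [/andP[k0 k1] _ _ _] := sP k.
  have [c1 c2] : (s k).1.1 <= r /\ penorm ((s k).1.2 - d) <= r by near: k.
  rewrite distrC (le_lt_trans (Lpsi _ _ k0 c1 c2))//.
  have ke : (s k).1.1 < e / (L * (penorm d + r)).
    apply: (lt_trans k1); near: k.
    exact: near_infty_natSinv_lt (PosNum e'0).
  rewrite ltr_pdivlMr ?mulr_gt0 ?ltr_wpDl ?penorm_ge0// in ke.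
  have dn : penorm (s k).1.2 <= penorm d + r.
    by have := penormD ((s k).1.2 - d) d; rewrite subrK; lra.
  apply: le_lt_trans ke; rewrite mulrCA ler_wpM2l ?(ltW k0)//.
  by rewrite ler_wpM2l// ltW.
- split; first by move=> k; have [] := sP k.
  by apply: cvg_penorm => k; have [] := sP k.
Unshelve. all: by end_near. Qed.

(** Supplies the steps along which criticality of [d] makes [f - psi]
    increase by [o(t)] at most: a limit superior is nearly attained arbitrarily close to the limit
    point. *)
Lemma upper_dini_attained psi zb d r L (a e del : R) :
  cone_lipschitz psi zb d r L -> (a%:E <= upper_dini psi zb d)%E ->
  0 < e -> 0 < del -> exists2 t, 0 < t < del &
    t * (a - e) <= fine (psi (zb + t *: d)) - fine (psi zb).
Proof.
move=> [[r0 _] fzb fpsi _ _] ad e0 del0.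
pose V := [set t : R | 0 < t < Num.min del r].
have VF : (0^'+ : set_system R) V.
  rewrite /V /=; near=> t; apply/andP; split; near: t.
    exact: nbhs_right_gt.
  by apply: nbhs_right_lt; rewrite lt_min del0.
have := le_trans ad (ereal_inf_lbound (ex_intro2 _ _ _ VF erefl)).
move=> asup.
have : ((a - e)%:E < ereal_sup ((fun t : R =>
    (psi (zb + t *: d)%R - psi zb) * (t^-1)%:E)%E @` V))%E.
  by apply: lt_le_trans asup; rewrite lte_fin ltrBlDr ltrDl.
move/ereal_sup_gt => [_ [t /andP[t0 tr] <-]].
move: tr; rewrite lt_min => /andP[tdel tr].
have ft : psi (zb + t *: d) \is a fin_num.
  by apply: fpsi => //; [exact: ltW|rewrite subrr penorm0 ltW].
rewrite -(fineK ft) -(fineK fzb) -EFinB -EFinM lte_fin => h.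
exists t; first by rewrite t0.
by rewrite mulrC -ler_pdivlMr// ltW.
Unshelve. all: by end_near. Qed.

End Directional.

(** * Stationarity of an exact penalty function *)

Section PenaltyStationarity.
Context {R : realType} {n m : nat}.
Local Notation E := ('rV[R]_n * 'rV[R]_m)%type.
Implicit Types (psi : E -> \bar R) (z zb d h w xi : E).

(** Differentiability at [zb] with gradient [a]. The uniformity over bounded sets
    of directions allows the direction [d + s *: h] to be perturbed while [t]
    tends to 0. *)
Definition cone_diff (phi : E -> R) zb (a : E) : Prop :=
  forall B e : R, 0 < e -> \forall t \near 0^'+, forall d', penorm d' <= B ->
    `|phi (zb + t *: d') - phi zb - t * pdot a d'| <= e * t.

Lemma cone_diff_along phi zb a d e : cone_diff phi zb a -> 0 < e ->
  \forall t \near 0^'+,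
    `|phi (zb + t *: d) - phi zb - t * pdot a d| <= e * t.
Proof.
by move=> ca e0; apply: filterS (ca (penorm d) e e0) => t /(_ _ (lexx _)).
Qed.

Definition penalty (I : finType) (f : E -> R) psi (c : I -> E -> R) z : R :=
  Num.max (f z - fine (psi z)) 0 + \sum_i Num.max (c i z) 0.

(** [zb], where the penalty vanishes, minimises [F + rho * penalty] up to [o(t)].
    The radius [r] comes before [e]: the direction [d + s *: h] is used with an
    error [e = s * s], so it must be admissible independently of [e]. *)
Definition cone_min (I : finType) (F f : E -> R) psi (c : I -> E -> R) zb d
    (rho : R) : Prop :=
  exists2 r : R, 0 < r & forall e, 0 < e -> \forall t \near 0^'+,
    forall d', penorm (d' - d) <= r ->
    - (e * t) <= F (zb + t *: d') - F zb +
      rho * penalty f psi c (zb + t *: d').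

Definition active (I : finType) (c : I -> E -> R) (ac : I -> E) zb d i :=
  (c i zb == 0) && (pdot (ac i) d == 0).

(** A constraint that is negative at [zb], or decreases at first order along [d],
    remains satisfied along [d + s *: h] for small [s], so that only the others
    contribute. *)
Lemma active_expansion (phi : E -> R) zb d a h :
  cone_diff phi zb a -> phi zb <= 0 -> (phi zb = 0 -> pdot a d <= 0) ->
  \forall s \near 0^'+, \forall t \near 0^'+,
    Num.max (phi (zb + t *: (d + s *: h))) 0 <=
      t * s * (if (phi zb == 0) && (pdot a d == 0)
               then Num.max (pdot a h) 0 else 0) + s * s * t.
Proof.
move=> ca; rewrite le_eqVlt => /orP[/eqP p0 /(_ p0)|p0 _].
- rewrite p0 eqxx/= le_eqVlt => /orP[/eqP ad|ad].
  + rewrite ad eqxx; near=> s.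
    have s0 : 0 < s by near: s; exact: nbhs_right_gt.
    near=> t; have t0 : 0 < t by near: t; exact: nbhs_right_gt.
    have : `|phi (zb + t *: (d + s *: h)) - phi zb - t * pdot a (d + s *: h)|
      <= s * s * t.
      by near: t; exact: (cone_diff_along _ ca (mulr_gt0 s0 s0)).
    rewrite p0 pdotDr ad pdotZr ler_norml => /andP[_ h1].
    have ts0 : 0 <= t * s by rewrite mulr_ge0 ?ltW.
    have m1 : pdot a h <= Num.max (pdot a h) 0 by rewrite le_max lexx.
    have m0 : 0 <= Num.max (pdot a h) 0 by rewrite le_max lexx orbT.
    rewrite ge_max; apply/andP; split; last first.
      by rewrite addr_ge0 ?(mulr_ge0 ts0 m0)// !mulr_ge0// ltW.
    have : t * s * pdot a h <= t * s * Num.max (pdot a h) 0 by rewrite ler_wpM2l.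
    by lra.
  + rewrite lt_eqF//; near=> s.
    have s0 : 0 < s by near: s; exact: nbhs_right_gt.
    have h1 : 0 < 1 + `|pdot a h| by rewrite ltr_pwDl.
    have sd : s * (1 + `|pdot a h|) < - pdot a d.
      rewrite -ltr_pdivlMr//; near: s; apply: nbhs_right_lt.
      by apply: divr_gt0; rewrite ?oppr_gt0.
    near=> t; have t0 : 0 < t by near: t; exact: nbhs_right_gt.
    have : `|phi (zb + t *: (d + s *: h)) - phi zb - t * pdot a (d + s *: h)|
      <= s * t.
      by near: t; exact: (cone_diff_along _ ca s0).
    rewrite p0 pdotDr pdotZr ler_norml => /andP[_ h2].
    have h3 := ler_norm (pdot a h).
    have h5 : 0 <= s * s * t by rewrite !mulr_ge0// ltW.
    rewrite mulr0 add0r ge_max h5 andbT.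
    have : t * (pdot a d + s * pdot a h + s) <= 0 by rewrite pmulr_rle0//; nra.
    by nra.
- rewrite lt_eqF//=; near=> s.
  have s0 : 0 < s by near: s; exact: nbhs_right_gt.
  have h1 : 0 < `|pdot a (d + s *: h)| + 1 by rewrite ltr_wpDl.
  near=> t; have t0 : 0 < t by near: t; exact: nbhs_right_gt.
  have : `|phi (zb + t *: (d + s *: h)) - phi zb - t * pdot a (d + s *: h)|
    <= 1 * t.
      by near: t; exact: (cone_diff_along _ ca ltr01).
  have : t * (`|pdot a (d + s *: h)| + 1) < - phi zb.
    rewrite -ltr_pdivlMr//; near: t; apply: nbhs_right_lt.
    by apply: divr_gt0; rewrite ?oppr_gt0.
  rewrite ler_norml => h2 /andP[_ h3].
  have h4 := ler_norm (pdot a (d + s *: h)).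
  have h5 : 0 <= s * s * t by rewrite !mulr_ge0// ltW.
  rewrite mulr0 add0r ge_max h5 andbT.
  by nra.
Unshelve. all: by end_near. Qed.

Lemma near_at_right0 (P : R -> Prop) : (\forall t \near 0^'+, P t) ->
  exists2 del : R, 0 < del & forall t, 0 < t < del -> P t.
Proof.
move=> /nbhs_right0P/nbhs_normP[del del0 h]; exists del => // t /andP[t0 tdel].
by have := h t; rewrite /= sub0r normrN gtr0_norm// add0r; exact.
Qed.

Section Stationarity.
Context (I : finType) (F f : E -> R) (c : I -> E -> R) (psi : E -> \bar R).
Context (zb d : E) (r L rho : R) (aF af : E) (ac : I -> E).
Context (Lpsi : cone_lipschitz psi zb d r L) (rho0 : 0 <= rho).
Context (F_diff : cone_diff F zb aF) (f_diff : cone_diff f zb af).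
Context (c_diff : forall i, cone_diff (c i) zb (ac i)).
Context (f_le : f zb <= fine (psi zb)) (c_le : forall i, c i zb <= 0).
Context (F_crit : pdot aF d <= 0).
Context (f_crit : ((pdot af d)%:E <= upper_dini psi zb d)%E).
Context (c_crit : forall i, c i zb = 0 -> pdot (ac i) d <= 0).
Context (Fmin : cone_min F f psi c zb d rho).

Definition slope xi h : R := pdot aF h +
  rho * (Num.max (pdot af h - pdot xi h) 0 +
         \sum_i (if active c ac zb d i then Num.max (pdot (ac i) h) 0 else 0)).

(** Moving from [zb + t *: d] by [t * s *: h], with [t] much smaller than [s] and
    chosen so that [psi] nearly realises its upper Dini derivative. All
    first-order terms along [d] are nonpositive, so minimality leaves only the
    slope along [h]. *)
Lemma penalty_step h : exists N : R, \forall s \near 0^'+,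
  exists t d' xi, [/\ 0 < t < s, penorm (d' - d) < s * (penorm h + 1),
    reg_subdiff psi (zb + t *: d') xi, penorm xi <= 2 * L &
    - (N * s) <= slope xi h].
Proof.
have [r' r'0 hmin] := Fmin.
have h0 := penorm_ge0 h.
have [[r0 L0] fzb fpsi _ _] := Lpsi.
exists (2 + rho * (3 + #|I|%:R)).
have hI : \forall s \near 0^'+, \forall t \near 0^'+, forall i,
    Num.max (c i (zb + t *: (d + s *: h))) 0 <=
      t * s * (if active c ac zb d i then Num.max (pdot (ac i) h) 0 else 0)
      + s * s * t.
  have /filter_forall := fun i =>
    active_expansion h (c_diff i) (c_le i) (@c_crit i).
  by apply: filterS => s; exact: filter_forall.
apply: filter_app hI; near=> s => hs.
have s0 : 0 < s by near: s; exact: nbhs_right_gt.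
have sh1 : s * (penorm h + 1) <= r.
  rewrite -ler_pdivlMr ?ltr_wpDl//; near: s; apply: nbhs_right_le.
  by rewrite divr_gt0// ltr_wpDl.
have sh2 : s * (penorm h + 1) <= r'.
  rewrite -ler_pdivlMr ?ltr_wpDl//; near: s; apply: nbhs_right_le.
  by rewrite divr_gt0// ltr_wpDl.
have ss0 : 0 < s * s by rewrite mulr_gt0.
pose d1 := d + s *: h.
have d1d : penorm (d1 - d) <= s * penorm h.
  by rewrite /d1 addrAC subrr add0r penormZ gtr0_norm.
have d1r : penorm (d1 - d) <= r' by apply: (le_trans d1d); nra.
have : \forall t \near 0^'+, [/\ t < s /\ t <= r,
    `|F (zb + t *: d1) - F zb - t * pdot aF d1| <= s * s * t,
    `|f (zb + t *: d1) - f zb - t * pdot af d1| <= s * s * t,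
    - (s * s * t) <= F (zb + t *: d1) - F zb + rho * penalty f psi c (zb + t *: d1) &
    forall i, Num.max (c i (zb + t *: d1)) 0 <=
      t * s * (if active c ac zb d i then Num.max (pdot (ac i) h) 0 else 0)
      + s * s * t].
  near=> t; split.
  - by split; near: t; [exact: nbhs_right_lt|exact: nbhs_right_le].
  - by near: t; exact: (cone_diff_along _ F_diff).
  - by near: t; exact: (cone_diff_along _ f_diff).
  - by near: t; apply: filterS (hmin _ ss0) => t /(_ d1 d1r).
  - near: t; exact: hs.
move=> /near_at_right0[del del0 hdel].
have [t tdel ht] := upper_dini_attained Lpsi f_crit ss0 del0.
have [[ts tr] hF hf hm hc] := hdel t tdel.
have /andP[t0 _] := tdel.
have [d' [xi [d'd sub xiL mv]]] := cone_subgradient Lpsi t0 tr s0 sh1.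
exists t, d', xi; split=> //; first by rewrite t0.
move: hm; rewrite /penalty.
set S := \sum_i Num.max _ _; set Z := Num.max (f _ - _) 0 => hm.
have ts0 : 0 < t * s by rewrite mulr_gt0.
have S1 : S <= t * s * (\sum_i (if active c ac zb d i
    then Num.max (pdot (ac i) h) 0 else 0)) + #|I|%:R * (s * s * t).
  apply: (le_trans (ler_sum _ (fun i _ => hc i))).
  by rewrite big_split/= -mulr_sumr sumr_const mulr_natl.
have Z1 : Z <= t * s * Num.max (pdot af h - pdot xi h) 0 + 3 * (s * s * t).
  have m1 : pdot af h - pdot xi h <= Num.max (pdot af h - pdot xi h) 0.
    by rewrite le_max lexx.
  have m0 : 0 <= Num.max (pdot af h - pdot xi h) 0 by rewrite le_max lexx orbT.
  have e0 : 0 <= s * s * t by rewrite !mulr_ge0// ltW.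
  have tm0 := mulr_ge0 (ltW ts0) m0.
  rewrite /Z ge_max; apply/andP; split; last by lra.
  move: hf; rewrite ler_norml => /andP[_ hf].
  have tm1 := ler_wpM2l (ltW ts0) m1.
  move: hf; rewrite /d1 !pdotE => hf.
  by move: ht mv f_le tm1; rewrite -/d1; lra.
rewrite -(ler_pM2l ts0) /slope.
set A := Num.max (pdot af h - _) 0 in Z1 *; set B := \sum_i _ in S1 *.
have H : rho * (Z + S) <=
    rho * (t * s * (A + B) + (3 + #|I|%:R) * (s * s * t)).
  by apply: ler_wpM2l => //; lra.
move: hF; rewrite ler_norml => /andP[_]; rewrite /d1 !pdotE -/d1 => hF.
have tF : t * pdot aF d <= 0 by rewrite pmulr_rle0.
by move: hm H hF tF; lra.
Unshelve. all: by end_near. Qed.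

(** A cluster point, as [s] tends to 0, of the subgradients of
    [penalty_step]. *)
Lemma slope_subgradient h :
  exists2 xi, bounded_dir_subgrads psi zb d (2 * L) xi & 0 <= slope xi h.
Proof.
have [N hN] := penalty_step h.
have [s0 s00 hs] := near_at_right0 hN.
have h0 := penorm_ge0 h.
have step e : 0 < e -> exists t d' xi, [/\ 0 < t < e, penorm (d' - d) < e,
    reg_subdiff psi (zb + t *: d') xi, penorm xi <= 2 * L & - e <= slope xi h].
  move=> e0.
  pose s := Num.min (s0 / 2) (e / (penorm h + `|N| + 1)).
  have N0 := normr_ge0 N.
  have D0 : 0 < penorm h + `|N| + 1 by lra.
  have sp : 0 < s by rewrite lt_min !divr_gt0.
  have ss0 : s < s0.
    have : s <= s0 / 2 by rewrite ge_min lexx.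
    lra.
  have se : s * (penorm h + `|N| + 1) <= e.
    by rewrite -ler_pdivlMr// ge_min lexx orbT.
  have := hs s; rewrite sp ss0 => /(_ isT)[t [d' [xi [/andP[t0 ts] d'd sub xiL sl]]]].
  have NN := ler_norm N.
  exists t, d', xi; split=> //; [rewrite t0/=; nra|nra|nra].
have /choice[x xP] : forall k : nat, exists x : E, [/\ penorm x <= 2 * L,
    - k.+1%:R^-1 <= slope x h & exists t d',
      [/\ 0 < t < k.+1%:R^-1, penorm (d' - d) < k.+1%:R^-1 &
       reg_subdiff psi (zb + t *: d') x]].
  move=> k; have k0 : 0 < k.+1%:R^-1 :> R by rewrite invr_gt0.
  by have [t [d' [xi [? ? ? ? ?]]]] := step _ k0; exists xi; split=> //; exists t, d'.
have xB : \forall k \near \oo, [set w | penorm (w - 0) <= 2 * L] (x k).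
  by near=> k; rewrite /= subr0; have [] := xP k.
have [xi [/= xiB xicl]] := @penorm_ball_compact R n m 0 (2 * L) (x @ \oo) _ xB.
have pick e : 0 < e -> exists2 k : nat, k.+1%:R^-1 < e & penorm (x k - xi) < e.
  move=> e0.
  have xe : \forall k \near \oo, [set x k | k in [set k | k.+1%:R^-1 < e]] (x k).
    near=> k; exists k => //=; near: k.
    exact: near_infty_natSinv_lt (PosNum e0).
  have [_ [[k ke <-] xke]] := xicl _ _ xe (nbhs_penorm_ball xi e0).
  by exists k.
exists xi.
  split=> [|e e0]; first by move: xiB; rewrite subr0.
  have [k ke xke] := pick e e0.
  have [_ _ [t [d' [/andP[t0 tk] d'd sub]]]] := xP k.
  exists t, d', (x k); split => //; [rewrite t0/=|]; exact: lt_trans ke.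
apply/ler_addgt0Pr => e e0.
have D0 : 0 < 1 + rho * penorm h by rewrite ltr_pwDl// mulr_ge0.
have [k ke xke] := pick _ (divr_gt0 e0 D0).
have [_ sk _] := xP k.
have : slope (x k) h <= slope xi h + rho * penorm h * penorm (x k - xi).
  rewrite /slope -[leRHS]addrA lerD2l -mulrA -mulrDr ler_wpM2l//.
  rewrite [leRHS]addrAC lerD2r.
  have := pdot_le (xi - x k) h; rewrite pdotBl (penormB xi) => hx.
  have m1 : pdot af h - pdot xi h <= Num.max (pdot af h - pdot xi h) 0.
    by rewrite le_max lexx.
  have m0 : 0 <= Num.max (pdot af h - pdot xi h) 0 by rewrite le_max lexx orbT.
  have p0 : 0 <= penorm h * penorm (x k - xi) by rewrite mulr_ge0 ?penorm_ge0.
  rewrite ge_max; apply/andP; split; lra.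
rewrite ltr_pdivlMr// in xke; rewrite ltr_pdivlMr// in ke.
have k0 : 0 < k.+1%:R^-1 :> R by rewrite invr_gt0.
have rh : 0 <= rho * penorm h by rewrite mulr_ge0.
have p0 := penorm_ge0 (x k - xi).
set K := k.+1%:R^-1 in sk ke k0.
set p := penorm (x k - xi) in xke p0 *.
move=> sx; have : K + rho * penorm h * p <= e by have [] := leP K p; nra.
by lra.
Unshelve. all: by end_near. Qed.

(** For every direction [h] some element of the compact convex set
    [aF + [0, rho] (af - co D) + \sum_i [0, rho] ac_i], with [i] active, has a
    nonnegative product with [h], by [slope_subgradient]; so the set contains
    0. *)
Lemma penalty_multipliers : exists alpha (l : I -> R) xi,
  [/\ 0 <= alpha /\ (forall i, 0 <= l i),
    forall i, ~~ active c ac zb d i -> l i = 0,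
    dir_clarke_subdiff psi zb d xi &
    aF + alpha *: (af - xi) + \sum_i l i *: ac i = 0].
Proof.
pose D := bounded_dir_subgrads psi zb d (2 * L).
pose H := hull D (n + m).
have D0 : D !=set0 by have [xi Dxi _] := slope_subgradient 0; exists xi.
pose b i := if active c ac zb d i then rho else 0.
have b0 i : 0 <= b i by rewrite /b; case: ifP.
pose fH := (fun xi => af - xi) @` H.
pose M := minkowski_sum [set aF]
  (minkowski_sum (scalings rho fH) (zonotope b ac (index_enum I))).
have uI := index_enum_uniq I.
have mem (alpha : R) xi (l : I -> R) : 0 <= alpha <= rho -> H xi ->
    (forall i, 0 <= l i <= b i) ->
    M (aF + (alpha *: (af - xi) + \sum_i l i *: ac i)).
  move=> ar Hxi lb.
  exists (aF, alpha *: (af - xi) + \sum_i l i *: ac i) => //; split=> //=.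
  exists (alpha *: (af - xi), \sum_i l i *: ac i) => //; split=> /=.
    exists (alpha, af - xi) => //; split=> /=; first by rewrite in_itv.
    by exists xi.
  by apply/zonotopeE => //; exists l.
have M0 : M 0.
  apply: compact_convex_has0.
  - have [xi Hxi] := hull0 (n + m) D0.
    exists (aF + (0 *: (af - xi) + \sum_i 0 *: ac i)).
    by apply: (mem 0 xi (fun=> 0)); rewrite ?lexx//= => i; rewrite lexx b0.
  - apply: minkowski_sum_compact; first exact: compact_set1.
    apply: minkowski_sum_compact; last exact: zonotope_compact.
    apply: scalings_compact; apply: continuous_compact.
      apply: continuous_subspaceT => x.
      by apply: cvgB; [exact: cvg_cst|exact: cvg_id].
    by apply: hull_compact; exact: bounded_dir_subgrads_compact.
  - apply: minkowski_sum_convex; first exact: set1_convex.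
    apply: minkowski_sum_convex; last exact: zonotope_convex.
    apply: scalings_convex => _ _ t [x Hx <-] [y Hy <-] t0 t1.
    exists ((1 - t) *: x + t *: y); first exact: hull_convex.
    by rewrite !scalerBr addrACA -scalerDl subrK scale1r opprD.
  - move=> h; have [xi Dxi sl] := slope_subgradient h.
    pose alpha := if 0 <= pdot af h - pdot xi h then rho else 0.
    pose l i := if 0 <= pdot (ac i) h then b i else 0.
    exists (aF + (alpha *: (af - xi) + \sum_i l i *: ac i)).
      apply: mem; first by rewrite /alpha; case: ifP; rewrite lexx rho0.
        exact: sub_hull.
      by move=> i; rewrite /l; case: ifP; rewrite lexx b0.
    move: sl; rewrite /slope mulrDr => sl.
    rewrite pdotDl (pdotDl (alpha *: _)) pdotZl pdotBl pdot_suml.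
    suff [-> ->] : alpha * (pdot af h - pdot xi h) =
          rho * Num.max (pdot af h - pdot xi h) 0 /\
        \sum_i pdot (l i *: ac i) h = rho * (\sum_i (if active c ac zb d i
          then Num.max (pdot (ac i) h) 0 else 0)) by [].
    split; first by rewrite /alpha maxC /Num.max lt_neqAle;
      case: ltgtP => // [_|<-]; rewrite ?mul0r ?mulr0.
    rewrite mulr_sumr; apply: eq_bigr => i _; rewrite pdotZl /l /b.
    case: (active _ _ _ _ _); last by rewrite !if_same mul0r mulr0.
    by rewrite maxC /Num.max; case: ltgtP => // [_|<-]; rewrite ?mul0r ?mulr0.
move: M0 => [[x y] [/= -> [[w z] [[[alpha v] [/= aI [xi Hxi <-]] /= <-]]]]].
move=> /= /zonotopeE[]// l lb -> <- e0.
exists alpha, l, xi; split.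
- split=> [|i]; last by have /andP[] := lb i.
  by move: aI; rewrite in_itv => /andP[].
- move=> i ni; have := lb i; rewrite /b (negbTE ni) => li.
  by apply/eqP; rewrite eq_le andbC.
- move=> B [cB DB]; apply: (hull_sub_convex (convex_set_segment_closed cB) _ Hxi).
  by move=> w0 Dw; apply: DB; exact: (bounded_dir_subgrads_sub Lpsi Dw).
- by rewrite -addrA.
Qed.

End Stationarity.
End PenaltyStationarity.

(** * First-order estimates along a direction *)

Section Calculus.
Context {R : realType} {n m : nat}.
Local Notation E := ('rV[R]_n * 'rV[R]_m)%type.
Implicit Types (psi : E -> \bar R) (z zb d : E).

Lemma differentiable_cone (W : normedModType R) (h : E -> W) zb (B e : R) :
  differentiable h zb -> 0 < e -> \forall t \near 0^'+,
    forall d', penorm d' <= B ->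
    `|h (zb + t *: d') - h zb - t *: ('d h zb d' : W)| <= e * t.
Proof.
move=> dh e0.
have B0 : 0 < `|B| + 1 by rewrite ltr_wpDl.
have /eqaddoP/(_ _ (divr_gt0 e0 B0)) := diff_locally dh.
move=> /nbhs_normP[del /= del0 hdel].
near=> t => d' d'B.
have t0 : 0 < t by near: t; exact: nbhs_right_gt.
have tB : t * (`|B| + 1) < del.
  by rewrite -ltr_pdivlMr//; near: t; apply: nbhs_right_lt; exact: divr_gt0.
have nd : `|d'| <= `|B|.
  by rewrite (le_trans (norm_le_penorm _))// (le_trans d'B)// ler_norm.
have td : `|t *: d'| <= t * (`|B| + 1).
  by rewrite normrZ gtr0_norm// ler_wpM2l ?(ltW t0)// (le_trans nd)// lerDl.
have := hdel (t *: d'); rewrite /= sub0r normrN => /(_ (le_lt_trans td tB)).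
rewrite !fctE/= linearZ/= (addrC (t *: d')) opprD addrA => /le_trans; apply.
by rewrite mulrAC ler_pdivrMr// -mulrA ler_wpM2l// ltW.
Unshelve. all: by end_near. Qed.

Lemma linear_pdot (A : E -> R) : (forall x y, A (x + y) = A x + A y) ->
  (forall t x, A (t *: x) = t * A x) -> forall d,
  A d = pdot (\row_i A (delta_mx 0 i, 0), \row_j A (0, delta_mx 0 j)) d.
Proof.
move=> AD AZ [d1 d2].
have A0 : A 0 = 0 by rewrite -(scale0r 0) AZ mul0r.
have dE : (d1, d2) = \sum_i d1 0 i *: ((delta_mx 0 i, 0) : E) +
    \sum_j d2 0 j *: ((0, delta_mx 0 j) : E) :> E.
  rewrite {1}[d1]row_sum_delta {1}[d2]row_sum_delta.
  apply/eqP; rewrite -pair_eqE /pair_eq/=.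
  rewrite !(big_morph fst (fun _ _ => erefl) erefl).
  rewrite !(big_morph snd (fun _ _ => erefl) erefl)/=.
  rewrite [X in _ == _ + X]big1 ?addr0 ?eqxx/=; last by move=> j _; exact: scaler0.
  by rewrite [X in _ == X + _]big1 ?add0r//; move=> j _; exact: scaler0.
rewrite [in LHS]dE AD !(big_morph A AD A0) /pdot/=.
by congr (_ + _); apply: eq_bigr => i _; rewrite AZ mulrC mxE.
Qed.

Lemma gradE (phi : E -> R) zb d : pdot (grad phi zb) d = 'd phi zb d.
Proof.
apply/esym/linear_pdot; first by move=> x y; rewrite linearD.
by move=> s x; rewrite linearZ.
Qed.

Lemma diff_scalar_cone (phi : E -> R) zb :
  differentiable phi zb -> cone_diff phi zb (grad phi zb).
Proof.
move=> dphi B e e0; apply: filterS (differentiable_cone B dphi e0) => t h d' d'B.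
by rewrite gradE; exact: h.
Qed.

Definition comp_grad k (h : E -> 'rV[R]_k) zb (i : 'I_k) : E :=
  jacT h zb (delta_mx 0 i).

Lemma dot_delta k (a : 'rV[R]_k) i : dot a (delta_mx 0 i) = a 0 i.
Proof.
rewrite /dot (bigD1 i)//= mxE !eqxx mulr1 big1 ?addr0// => j ji.
by rewrite mxE (negbTE ji) andbF mulr0.
Qed.

Lemma comp_gradE k (h : E -> 'rV[R]_k) zb i d :
  pdot (comp_grad h zb i) d = 'd h zb d 0 i.
Proof.
rewrite (@linear_pdot (fun d => ('d h zb d : 'rV[R]_k) 0 i)).
- by congr pdot; congr pair; apply/rowP => j; rewrite !mxE dot_delta.
- by move=> x y; rewrite linearD mxE.
- by move=> s x; rewrite linearZ mxE.
Qed.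

Lemma jacT_sum k (h : E -> 'rV[R]_k) zb l :
  jacT h zb l = \sum_i l 0 i *: comp_grad h zb i.
Proof.
apply/eqP; rewrite -pair_eqE /pair_eq/=.
rewrite !(big_morph fst (fun _ _ => erefl) erefl).
rewrite !(big_morph snd (fun _ _ => erefl) erefl)/=.
by apply/andP; split; apply/eqP/rowP => j; rewrite summxE mxE; apply: eq_bigr => i _;
  rewrite !mxE dot_delta mulrC.
Qed.

Lemma diff_comp_cone k (h : E -> 'rV[R]_k) zb i :
  differentiable h zb -> cone_diff (fun z => h z 0 i) zb (comp_grad h zb i).
Proof.
move=> dh B e e0; apply: filterS (differentiable_cone B dh e0) => t ht d' d'B.
rewrite comp_gradE; apply: le_trans (ht _ d'B).
rewrite [leRHS]/Num.norm/= mx_normrE; apply/bigmax_geP; right.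
by exists (0, i) => //=; rewrite !mxE.
Qed.

End Calculus.

Section PenaltyEstimates.
Context {R : realType} {n m : nat}.
Local Notation E := ('rV[R]_n * 'rV[R]_m)%type.
Implicit Types (phi : E -> R) (zb d a : E).

Lemma cone_diff_lip phi zb a B e : cone_diff phi zb a -> 0 < e ->
  \forall t \near 0^'+, forall d1 d2, penorm d1 <= B -> penorm d2 <= B ->
    `|phi (zb + t *: d1) - phi (zb + t *: d2)|
      <= penorm a * (t * penorm (d1 - d2)) + e * t.
Proof.
move=> ca e0; have e20 : 0 < e / 2 by rewrite divr_gt0.
near=> t => d1 d2 d1B d2B.
have t0 : 0 < t by near: t; exact: nbhs_right_gt.
have H : forall d', penorm d' <= B ->
    `|phi (zb + t *: d') - phi zb - t * pdot a d'| <= e / 2 * t.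
  by near: t; exact: ca.
move: (H _ d1B) (H _ d2B); rewrite !ler_norml => /andP[h1 h2] /andP[h3 h4].
have := pdot_cauchy a (d1 - d2); rewrite pdotBr ler_norml => /andP[h5 h6].
have h7 := ler_wpM2l (ltW t0) h5; have h8 := ler_wpM2l (ltW t0) h6.
by apply/andP; split; lra.
Unshelve. all: by end_near. Qed.

Lemma cone_diff_cont phi zb a B e : cone_diff phi zb a -> 0 < e ->
  \forall t \near 0^'+, forall d', penorm d' <= B ->
    `|phi (zb + t *: d') - phi zb| <= e.
Proof.
move=> ca e0.
have D0 : 0 < penorm a * `|B| + 1.
  by rewrite ltr_wpDl// mulr_ge0 ?penorm_ge0 ?normr_ge0.
near=> t => d' d'B.
have t0 : 0 < t by near: t; exact: nbhs_right_gt.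
have H : forall d', penorm d' <= B ->
    `|phi (zb + t *: d') - phi zb - t * pdot a d'| <= 1 * t.
  by near: t; exact: ca.
have te : t * (penorm a * `|B| + 1) < e.
  by rewrite -ltr_pdivlMr//; near: t; apply: nbhs_right_lt; exact: divr_gt0.
have hp : `|pdot a d'| <= penorm a * `|B|.
  rewrite (le_trans (pdot_cauchy _ _))// ler_wpM2l ?penorm_ge0//.
  by rewrite (le_trans d'B)// ler_norm.
have := H _ d'B; move: hp; rewrite !ler_norml => /andP[h1 h2] /andP[h3 h4].
have h5 := ler_wpM2l (ltW t0) h1; have h6 := ler_wpM2l (ltW t0) h2.
by apply/andP; split; lra.
Unshelve. all: by end_near. Qed.

(** When [phi zb = 0], the increment in direction [d'] is at most
    [t <a, d' - d> + o(t)] because [<a, d> <= 0]; otherwise [phi] stays negative by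
    continuity. *)
Lemma violation_small phi zb d a r : cone_diff phi zb a -> phi zb <= 0 ->
  (phi zb = 0 -> pdot a d <= 0) -> 0 < r ->
  \forall t \near 0^'+, forall d', penorm (d' - d) <= r ->
    Num.max (phi (zb + t *: d')) 0 <= (penorm a + 1) * r * t.
Proof.
move=> ca p0 crit r0; have a0 := penorm_ge0 a; have d0 := penorm_ge0 d.
have nt : \forall t \near 0^'+, t * pdot a d <= - phi zb.
  move: p0; rewrite le_eqVlt => /orP[/eqP z|neg].
    by near=> t; rewrite z oppr0 pmulr_rle0//; exact: crit.
  have D0 : 0 < `|pdot a d| + 1 by rewrite ltr_wpDl.
  near=> t; apply: (@le_trans _ _ (t * (`|pdot a d| + 1))).
    rewrite ler_wpM2l// (le_trans (ler_norm _))// lerDl//.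
  rewrite ltW// -ltr_pdivlMr//; near: t; apply: nbhs_right_lt.
  by apply: divr_gt0; rewrite ?oppr_gt0.
near=> t => d' d'r.
have t0 : 0 < t by near: t; exact: nbhs_right_gt.
have d'B : penorm d' <= penorm d + r.
  by have := penormD (d' - d) d; rewrite subrK; lra.
rewrite ge_max; apply/andP; split; last first.
  by rewrite !mulr_ge0 ?addr_ge0// ltW.
have H : forall d', penorm d' <= penorm d + r ->
    `|phi (zb + t *: d') - phi zb - t * pdot a d'| <= r * t.
  by near: t; exact: ca.
have := H _ d'B; rewrite ler_norml => /andP[_ h1].
have := pdot_le a (d' - d); rewrite pdotBr => h2.
have h2' : pdot a d' - pdot a d <= penorm a * r.
  by apply: (le_trans h2); rewrite ler_wpM2l.
have h3 := ler_wpM2l (ltW t0) h2'.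
have h4 : t * pdot a d <= - phi zb by near: t.
by lra.
Unshelve. all: by end_near. Qed.

Context (psi : E -> \bar R) (zb d : E) (r L : R).
Context (Lpsi : cone_lipschitz psi zb d r L).
Context (I : finType) (f : E -> R) (c : I -> E -> R) (af : E) (ac : I -> E).
Context (f_diff : cone_diff f zb af).
Context (c_diff : forall i, cone_diff (c i) zb (ac i)).

Lemma penalty_small e : f zb <= fine (psi zb) -> (forall i, c i zb <= 0) ->
  0 < e -> \forall t \near 0^'+, forall d', penorm (d' - d) <= r ->
    penalty f psi c (zb + t *: d') < e.
Proof.
move=> f_le c_le e0; have [[r0 L0] _ _ _ Lp] := Lpsi.
have N0 : 0 < 3 + #|I|%:R :> R by rewrite ltr_wpDr.
pose e1 := e / (3 + #|I|%:R); have e10 : 0 < e1 by rewrite divr_gt0.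
have d0 := penorm_ge0 d.
have dr0 : 0 < L * (penorm d + r) by rewrite mulr_gt0// ltr_wpDl.
have hI : \forall t \near 0^'+, forall i, forall d', penorm d' <= penorm d + r ->
    `|c i (zb + t *: d') - c i zb| <= e1.
  by apply: filter_forall => i; exact: cone_diff_cont.
near=> t => d' d'r.
have t0 : 0 < t by near: t; exact: nbhs_right_gt.
have d'B : penorm d' <= penorm d + r.
  by have := penormD (d' - d) d; rewrite subrK; lra.
have hc : forall i, forall d', penorm d' <= penorm d + r ->
    `|c i (zb + t *: d') - c i zb| <= e1 by near: t; exact: hI.
have hf : forall d', penorm d' <= penorm d + r ->
    `|f (zb + t *: d') - f zb| <= e1 by near: t; exact: (cone_diff_cont _ f_diff).
have tr : t <= r by near: t; exact: nbhs_right_le.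
have hp := Lp _ _ t0 tr d'r.
have te : t * (L * (penorm d + r)) < e1.
  by rewrite -ltr_pdivlMr//; near: t; apply: nbhs_right_lt; exact: divr_gt0.
have hpe : L * (t * penorm d') <= e1.
  apply: le_trans (ltW te); rewrite mulrCA ler_wpM2l ?(ltW t0)//.
  by rewrite ler_wpM2l// ltW.
have hc' i : Num.max (c i (zb + t *: d')) 0 <= e1.
  rewrite ge_max (ltW e10) andbT; have := hc i _ d'B.
  by rewrite ler_norml => /andP[_ h]; have := c_le i; lra.
rewrite /penalty.
apply: (@le_lt_trans _ _ (2 * e1 + #|I|%:R * e1)).
  rewrite lerD//; last first.
    apply: (le_trans (ler_sum _ (fun i _ => hc' i))).
    by rewrite sumr_const mulr_natl.
  rewrite ge_max mulr_ge0 ?(ltW e10)// andbT.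
  have := hf _ d'B; move: hp; rewrite !ler_norml => /andP[h1 h2] /andP[h3 h4].
  by lra.
have : e1 * (3 + #|I|%:R) = e by rewrite divfK// gt_eqF.
by lra.
Unshelve. all: by end_near. Qed.

Lemma max0_lip (x y : R) : Num.max x 0 <= Num.max y 0 + `|x - y|.
Proof.
have m1 : y <= Num.max y 0 by rewrite le_max lexx.
have m0 : 0 <= Num.max y 0 by rewrite le_max lexx orbT.
have h1 := ler_norm (x - y); have h0 := normr_ge0 (x - y).
by rewrite ge_max; apply/andP; split; lra.
Qed.

Lemma penalty_lip e : 0 < e -> \forall t \near 0^'+, forall d1 d2,
  penorm (d1 - d) <= r -> penorm (d2 - d) <= r ->
  penalty f psi c (zb + t *: d1) <= penalty f psi c (zb + t *: d2) +
    (penorm af + L + \sum_i penorm (ac i)) * (t * penorm (d1 - d2)) +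
    (1 + #|I|%:R) * (e * t).
Proof.
move=> e0; have [[r0 L0] _ _ Lp _] := Lpsi.
have hI : \forall t \near 0^'+, forall i, forall d1 d2,
    penorm d1 <= penorm d + r -> penorm d2 <= penorm d + r ->
    `|c i (zb + t *: d1) - c i (zb + t *: d2)|
      <= penorm (ac i) * (t * penorm (d1 - d2)) + e * t.
  by apply: filter_forall => i; exact: cone_diff_lip.
near=> t => d1 d2 d1r d2r.
have t0 : 0 < t by near: t; exact: nbhs_right_gt.
have tr : t <= r by near: t; exact: nbhs_right_le.
have d1B : penorm d1 <= penorm d + r.
  by have := penormD (d1 - d) d; rewrite subrK; lra.
have d2B : penorm d2 <= penorm d + r.
  by have := penormD (d2 - d) d; rewrite subrK; lra.
have hc : forall i, forall d1 d2,
    penorm d1 <= penorm d + r -> penorm d2 <= penorm d + r ->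
    `|c i (zb + t *: d1) - c i (zb + t *: d2)|
      <= penorm (ac i) * (t * penorm (d1 - d2)) + e * t by near: t; exact: hI.
have hf : forall d1 d2, penorm d1 <= penorm d + r -> penorm d2 <= penorm d + r ->
    `|f (zb + t *: d1) - f (zb + t *: d2)|
      <= penorm af * (t * penorm (d1 - d2)) + e * t.
  by near: t; exact: (cone_diff_lip _ f_diff).
have hp := Lp _ _ _ t0 tr d1r d2r.
set D := t * penorm (d1 - d2) in hp *.
have hc' i : Num.max (c i (zb + t *: d1)) 0 <=
    Num.max (c i (zb + t *: d2)) 0 + (penorm (ac i) * D + e * t).
  by apply: le_trans (max0_lip _ (c i (zb + t *: d2))) _; rewrite lerD2l hc.
have := ler_sum (index_enum I) (P := predT) (fun i _ => hc' i).
rewrite !big_split/= sumr_const -mulr_suml => hS.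
rewrite /penalty.
set u := f (zb + t *: d1) - _; set v := f (zb + t *: d2) - _.
have huv : `|u - v| <= (penorm af + L) * D + e * t.
  have := hf _ _ d1B d2B; move: hp; rewrite /u /v -/D.
  by rewrite !ler_norml => /andP[h1 h2] /andP[h3 h4]; apply/andP; split; lra.
have := max0_lip u v; move: hS; rewrite -mulr_natl; lra.
Unshelve. all: by end_near. Qed.

End PenaltyEstimates.

(** * From calmness to an exact penalty *)

Section Calmness.
Context {R : realType} {n m p q : nat}.
Local Notation E := ('rV[R]_n * 'rV[R]_m)%type.
Context (F f : E -> R) (g : E -> 'rV[R]_p) (G : E -> 'rV[R]_q) (gamma : R).
Context (zb d : E).
Local Notation psi := (moreau f g gamma).

Definition constraint (i : 'I_p + 'I_q) z : R :=
  match i with inl i => g z 0 i | inr j => G z 0 j end.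

Definition constraint_grad (i : 'I_p + 'I_q) : E :=
  match i with inl i => comp_grad g zb i | inr j => comp_grad G zb j end.

Context (F_diff : differentiable F zb) (f_diff : differentiable f zb).
Context (g_diff : differentiable g zb) (G_diff : differentiable G zb).
Context (Lpsi : exists r L, cone_lipschitz psi zb d r L).
Context (zb_feasible : VP_feasible f g G gamma zb).

Lemma dot_le_sqr_sum k (a : 'rV[R]_k) : vnonneg a ->
  dot a a <= (\sum_i a 0 i) ^+ 2.
Proof.
move=> a0; rewrite expr2 mulr_suml; apply: ler_sum => i _.
by rewrite ler_wpM2l// (bigD1 i)//= lerDl sumr_ge0.
Qed.

Lemma vpos_part_nonneg k (a : 'rV[R]_k) : vnonneg (vpos_part a).
Proof. by move=> i; rewrite mxE le_max lexx orbT. Qed.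

Lemma sum_vpos_part k (a : 'rV[R]_k) :
  \sum_i vpos_part a 0 i = \sum_i Num.max (a 0 i) 0.
Proof. by apply: eq_bigr => i _; rewrite mxE. Qed.

Lemma sqrt_le_sum k l (x : R) (a : 'rV[R]_k) (b : 'rV[R]_l) : 0 <= x ->
  Num.sqrt ((- x) ^+ 2 + dot (- vpos_part a) (- vpos_part a) +
            dot (- vpos_part b) (- vpos_part b)) <=
  x + (\sum_i Num.max (a 0 i) 0 + \sum_j Num.max (b 0 j) 0).
Proof.
move=> x0; have dN j (c : 'rV[R]_j) : dot (- c) (- c) = dot c c.
  by apply: eq_bigr => i _; rewrite !mxE mulrNN.
have := dot_le_sqr_sum (vpos_part_nonneg a).
have := dot_le_sqr_sum (vpos_part_nonneg b).
rewrite !sum_vpos_part !dN sqrrN.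
set s1 := \sum_i _; set s2 := \sum_i _ => h2 h1.
have s10 : 0 <= s1 by apply: sumr_ge0 => i _; rewrite le_max lexx orbT.
have s20 : 0 <= s2 by apply: sumr_ge0 => i _; rewrite le_max lexx orbT.
rewrite -[leRHS]ger0_norm ?addr_ge0// -sqrtr_sqr ler_wsqrtr//; nra.
Qed.

Lemma enorm_vpos_part_le k (a : 'rV[R]_k) :
  enorm (vpos_part a) <= \sum_i Num.max (a 0 i) 0.
Proof.
rewrite -sum_vpos_part -[leRHS]ger0_norm; last first.
  by apply: sumr_ge0 => i _; exact: vpos_part_nonneg.
by rewrite -sqrtr_sqr ler_wsqrtr// dot_le_sqr_sum//; exact: vpos_part_nonneg.
Qed.

Lemma add_neg_vpos_part k (a : 'rV[R]_k) : vnonpos (a + - vpos_part a).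
Proof. by move=> i; rewrite !mxE subr_le0 le_max lexx. Qed.

Lemma value_gap_le0 z : psi z \is a fin_num ->
  ((f z)%:E - psi z + (- Num.max (f z - fine (psi z)) 0)%:E <= 0)%E.
Proof.
case: (psi z) => [v||]//= _; rewrite -!EFinB lee_fin.
by rewrite subr_le0 le_max lexx.
Qed.

Lemma feasible_value_le : psi zb \is a fin_num -> f zb <= fine (psi zb).
Proof.
move=> fzb; have [+ _ _] := zb_feasible.
by rewrite -(fineK fzb) -EFinB lee_fin subr_le0.
Qed.

Lemma constraint_diff i : cone_diff (constraint i) zb (constraint_grad i).
Proof. by case: i => i; exact: diff_comp_cone. Qed.

Lemma constraint_le0 i : constraint i zb <= 0.
Proof. by have [_ gb Gb] := zb_feasible; case: i => i /=. Qed.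

(** The perturbation [(a, b, c)] that makes [z] feasible and has the least norm
    consists of the violations at [z] with opposite sign, and its norm is at most
    the penalty. *)
Lemma calm_cone_min : VP_calm F f g G gamma zb d ->
  exists2 rho, 0 <= rho & cone_min F f psi constraint zb d rho.
Proof.
move=> [eps [del [rho [eps0 del0 rho0 calm]]]].
have [r0 [L Lp]] := Lpsi; have [[r00 L0] fzb fp _ _] := Lp.
have [r1 r10 hr1] := dir_nbhd_cone d eps0 del0.
have f_le := feasible_value_le fzb.
exists rho; first exact: ltW.
exists (Num.min r0 r1); first by rewrite lt_min r00.
move=> e e0; near=> t => d'; rewrite le_min => /andP[d'r0 d'r1].
have t0 : 0 < t by near: t; exact: nbhs_right_gt.
have tr0 : t <= r0 by near: t; exact: nbhs_right_le.
have tr1 : t <= r1 by near: t; exact: nbhs_right_le.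
have psmall : forall d', penorm (d' - d) <= r0 ->
    penalty f psi constraint (zb + t *: d') < eps.
  near: t; apply: (penalty_small Lp (diff_scalar_cone f_diff)) => //.
  - exact: constraint_diff.
  - exact: constraint_le0.
have {}psmall := psmall _ d'r0.
set z := zb + t *: d' in psmall *.
have zV : dir_nbhd eps del d (z - zb).
  by rewrite /z addrAC subrr add0r; exact: hr1.
have fz : psi z \is a fin_num by exact: fp.
have x0 : 0 <= Num.max (f z - fine (psi z)) 0 by rewrite le_max lexx orbT.
have sq := sqrt_le_sum (g z) (G z) x0.
have penE : penalty f psi constraint z = Num.max (f z - fine (psi z)) 0 +
    (\sum_i Num.max (g z 0 i) 0 + \sum_j Num.max (G z 0 j) 0).
  by rewrite /penalty big_sumType.
rewrite -penE in sq.
have := calm _ _ _ z (le_lt_trans sq psmall) zV (value_gap_le0 fz)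
  (add_neg_vpos_part (g z)) (add_neg_vpos_part (G z)).
have := ler_wpM2l (ltW rho0) sq.
have : 0 <= e * t by rewrite mulr_ge0// ltW.
by lra.
Unshelve. all: by end_near. Qed.

(** The arithmetic of the passage from [z'] to [z], where [F1], [P1] and [F0],
    [P0] stand for objective and penalty at [z'] and at [z], [Fb] for the
    objective at [zb], [D] for the distance and [Pg] for the violation of the
    constraints that metric subregularity removes. *)
Lemma penalty_transfer (F1 F0 Fb P1 P0 Pg D nF nP q1 rh ka e e1 : R) :
  0 <= rh -> 0 <= ka -> 0 <= nF + rh * nP -> 0 <= P0 -> 0 <= Pg ->
  P1 <= P0 + nP * D + q1 * e1 -> F1 - F0 <= nF * D + e1 -> D <= ka * Pg + e1 ->
  0 <= F1 - Fb + rh * P1 -> (nF + rh * nP + (1 + rh * q1)) * e1 <= e ->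
  - e <= F0 - Fb + (rh + (nF + rh * nP) * ka) * (Pg + P0).
Proof.
move=> rh0 ka0 C0 P00 Pg0 hP hF hD hcal he.
have h1 := ler_wpM2l rh0 hP; have h2 := ler_wpM2l C0 hD.
have h3 := mulr_ge0 rh0 Pg0; have h4 := mulr_ge0 (mulr_ge0 C0 ka0) P00.
by clear -h1 h2 h3 h4 hF hcal he; lra.
Qed.

Context (g_crit : forall i, g zb 0 i = 0 -> 'd g zb d 0 i <= 0).

(** Under partial calmness the lower-level constraints have to hold exactly.
    Metric subregularity replaces [z] by a point [z'] with [g z' <= 0] at a
    distance at most [kappa * |g_+ z| + o(t)]; by [violation_small] this is a small
    multiple of [t], so [z'] is still in the directional neighborhood, and the
    Lipschitz estimates turn the change of [F], [f], [psi] and [G] into a multiple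
    of [|g_+ z|]. *)
Lemma partially_calm_cone_min :
  VP_partially_calm F f g G gamma zb d -> dir_MSCQ g zb d ->
  exists2 rho, 0 <= rho & cone_min F f psi constraint zb d rho.
Proof.
move=> [eps [del [rho [eps0 del0 rho0 calm]]]].
move=> [eps2 [del2 [kappa [eps20 del20 kappa0 mscq]]]].
have [r0 [L Lp]] := Lpsi; have [[r00 L0] fzb fp _ _] := Lp.
have [r1 r10 hr1] := dir_nbhd_cone d eps0 del0.
have [r2 r20 hr2] := dir_nbhd_cone d eps20 del20.
have f_le := feasible_value_le fzb.
have [_ gb Gb] := zb_feasible.
pose Gc j z : R := G z 0 j.
have Gc_diff j : cone_diff (Gc j) zb (comp_grad G zb j) by exact: diff_comp_cone.
pose Sg := \sum_i (penorm (comp_grad g zb i) + 1).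
have Sg0 : 0 <= Sg by apply: sumr_ge0 => i _; rewrite addr_ge0 ?penorm_ge0.
(* [R1] is the radius allowed for the direction of [z']. The choice of [r] and
   [e1] gives [kappa * Sg * r + e1 <= R1 / 2], the bound on the change of direction
   from [z] to [z']. *)
pose R1 := Num.min r0 r1; have R10 : 0 < R1 by rewrite lt_min r00.
have R1r0 : R1 <= r0 by rewrite ge_min lexx.
have R1r1 : R1 <= r1 by rewrite ge_min lexx orbT.
have k1 : 0 < kappa * Sg + 1 by rewrite ltr_wpDl// mulr_ge0// ltW.
pose r := Num.min (Num.min r2 (R1 / 4)) (R1 / 4 / (kappa * Sg + 1)).
have rp : 0 < r by rewrite !lt_min r20 !divr_gt0.
have rr2 : r <= r2 by rewrite !ge_min lexx.
have rR1 : r <= R1 / 4 by rewrite !ge_min lexx orbT.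
have rk : kappa * Sg * r <= R1 / 4.
  have : r * (kappa * Sg + 1) <= R1 / 4.
    by rewrite -ler_pdivlMr// ge_min lexx orbT.
  by have := ltW rp; nra.
pose aF := grad F zb; pose af := grad f zb.
pose C := penorm aF + rho * (penorm af + L + \sum_j penorm (comp_grad G zb j)).
have C0 : 0 <= C.
  rewrite /C addr_ge0 ?penorm_ge0// mulr_ge0 ?(ltW rho0)//.
  rewrite addr_ge0 ?addr_ge0 ?penorm_ge0 ?(ltW L0)//.
  by apply: sumr_ge0 => j _; exact: penorm_ge0.
pose N : R := 1 + rho * (1 + #|'I_q|%:R).
have N0 : 0 < N by rewrite /N ltr_pwDl// mulr_ge0 ?(ltW rho0)// addr_ge0.
exists (rho + C * kappa).
  by rewrite addr_ge0 ?(ltW rho0)// mulr_ge0// ltW.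
exists r => // e e0.
have CN0 : 0 < C + N by rewrite ltr_wpDl.
pose e1 := Num.min (R1 / 4) (e / (C + N)).
have e10 : 0 < e1 by rewrite lt_min !divr_gt0.
have e1R : e1 <= R1 / 4 by rewrite ge_min lexx.
have e1e : e1 * (C + N) <= e by rewrite -ler_pdivlMr// ge_min lexx orbT.
have hviol : \forall t \near 0^'+, forall i, forall d', penorm (d' - d) <= r ->
    Num.max (g (zb + t *: d') 0 i) 0 <= (penorm (comp_grad g zb i) + 1) * r * t.
  apply: filter_forall => i.
  apply: (violation_small (diff_comp_cone i g_diff) (gb i) _ rp).
  by move=> /g_crit; rewrite comp_gradE.
have hpen := penalty_lip Lp (diff_scalar_cone f_diff) Gc_diff e10.
have hsmall := penalty_small Lp (diff_scalar_cone f_diff) Gc_diff f_le Gb eps0.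
have hF := cone_diff_lip (penorm d + R1) (diff_scalar_cone F_diff) e10.
near=> t => d' d'r.
have t0 : 0 < t by near: t; exact: nbhs_right_gt.
have tr0 : t <= r0 by near: t; exact: nbhs_right_le.
have tr1 : t <= r1 by near: t; exact: nbhs_right_le.
have tr2 : t <= r2 by near: t; exact: nbhs_right_le.
have viol : forall i, forall d', penorm (d' - d) <= r ->
    Num.max (g (zb + t *: d') 0 i) 0 <= (penorm (comp_grad g zb i) + 1) * r * t.
  by near: t; exact: hviol.
have {}viol i := viol i d' d'r.
set z := zb + t *: d' in viol *.
set Pg := \sum_i Num.max (g z 0 i) 0.
have Pg0 : 0 <= Pg by apply: sumr_ge0 => i _; rewrite le_max lexx orbT.
have PgS : Pg <= Sg * r * t.
  by rewrite /Sg !mulr_suml; apply: ler_sum => i _; exact: viol.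
have zV : dir_nbhd eps2 del2 d (z - zb).
  by rewrite /z addrAC subrr add0r; apply: hr2 => //; exact: le_trans rr2.
have [z' gz' zz'] : exists2 z', vnonpos (g z') &
    penorm (z - z') <= kappa * Pg + e1 * t.
  have : (edist_set z [set z' | vnonpos (g z')] < (kappa * Pg + e1 * t)%:E)%E.
    apply: (le_lt_trans (mscq _ zV)); rewrite lte_fin.
    apply: (@le_lt_trans _ _ (kappa * Pg)); last by rewrite ltrDl mulr_gt0.
    by rewrite ler_wpM2l ?(ltW kappa0)// enorm_vpos_part_le.
  move/ereal_inf_lt => [_ [z' gz' <-]]; rewrite lte_fin => lt.
  by exists z' => //; exact: ltW.
pose d2 := t^-1 *: (z' - zb).
have z'E : z' = zb + t *: d2.
  by rewrite /d2 scalerA mulfV ?gt_eqF// scale1r addrC subrK.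
have tdd : t * penorm (d2 - d') = penorm (z - z').
  rewrite [in RHS]z'E /z (addrC zb) addrKA -scalerBr penormZ gtr0_norm//.
  by rewrite penormB.
have dd2 : penorm (d2 - d') <= kappa * Sg * r + e1.
  rewrite -(ler_pM2l t0) tdd (le_trans zz')//.
  have := ler_wpM2l (ltW kappa0) PgS; lra.
have d2R : penorm (d2 - d) <= R1.
  by have := penorm_distD d2 d' d; lra.
have d'R : penorm (d' - d) <= R1 by lra.
have d'B : penorm d' <= penorm d + R1.
  by have := penormD (d' - d) d; rewrite subrK; lra.
have d2B : penorm d2 <= penorm d + R1.
  by have := penormD (d2 - d) d; rewrite subrK; lra.
have psmall : forall d', penorm (d' - d) <= r0 ->
    penalty f psi Gc (zb + t *: d') < eps by near: t; exact: hsmall.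
have {}psmall := psmall d2 (le_trans d2R R1r0).
have plip : forall d1 d2, penorm (d1 - d) <= r0 -> penorm (d2 - d) <= r0 ->
    penalty f psi Gc (zb + t *: d1) <= penalty f psi Gc (zb + t *: d2) +
    (penorm af + L + \sum_j penorm (comp_grad G zb j)) * (t * penorm (d1 - d2)) +
    (1 + #|'I_q|%:R) * (e1 * t) by near: t; exact: hpen.
have {}plip := plip d2 d' (le_trans d2R R1r0) (le_trans d'R R1r0).
have Flip : forall d1 d2, penorm d1 <= penorm d + R1 ->
    penorm d2 <= penorm d + R1 -> `|F (zb + t *: d1) - F (zb + t *: d2)|
      <= penorm aF * (t * penorm (d1 - d2)) + e1 * t by near: t; exact: hF.
have {}Flip := le_trans (ler_norm _) (Flip d2 d' d2B d'B).
rewrite -z'E -/z tdd in plip Flip psmall.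
have z'V : dir_nbhd eps del d (z' - zb).
  by rewrite z'E addrAC subrr add0r; apply: hr1 => //; exact: le_trans R1r1.
have fz' : psi z' \is a fin_num.
  by rewrite z'E; apply: fp => //; exact: le_trans R1r0.
have x0 : 0 <= Num.max (f z' - fine (psi z')) 0 by rewrite le_max lexx orbT.
(* The lower-level constraints hold at [z'], so their block is empty here. *)
have sq := @sqrt_le_sum 0 q _ 0 (G z') x0.
rewrite [dot (- vpos_part 0) _]big_ord0 addr0 big_ord0 add0r in sq.
have := calm _ _ z' (le_lt_trans sq psmall) _ z'V (value_gap_le0 fz')
  (add_neg_vpos_part (G z')).
have gz'' : lower_feasible g z'.1 z'.2.
  by rewrite /lower_feasible /= -surjective_pairing.
move=> /(_ gz'') {}calm.
have penE : penalty f psi constraint z = Pg + penalty f psi Gc z.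
  by rewrite /penalty big_sumType/= addrCA.
have P0 : 0 <= penalty f psi Gc z.
  rewrite addr_ge0 ?le_max ?lexx ?orbT//.
  by apply: sumr_ge0 => j _; rewrite le_max lexx orbT.
rewrite penE.
apply: (penalty_transfer (ltW rho0) (ltW kappa0) C0 P0 Pg0 plip Flip zz').
- by apply: (le_trans calm); rewrite lerD2l; apply: ler_wpM2l sq; exact: ltW.
- by rewrite mulrA ler_wpM2r// ?(ltW t0)// mulrC.
Unshelve. all: by end_near. Qed.

End Calmness.

(** * Directional necessary optimality conditions *)

Theorem theorem5p1 (R : realType) (n m p q : nat)
  (F f : 'rV[R]_n * 'rV[R]_m -> R)
  (g : 'rV[R]_n * 'rV[R]_m -> 'rV[R]_p)
  (G : 'rV[R]_n * 'rV[R]_m -> 'rV[R]_q)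
  (gamma : R) (xb u : 'rV[R]_n) (yb v : 'rV[R]_m)
  (F_C1 : C1 F) (f_C1 : C1 f) (g_C1 : C1 g) (G_C1 : C1 G)
  (f_wconvex : forall x, weakly_convex (fun y => f (x, y)))
  (g_qconvex : forall x i, quasi_convex (fun y => g (x, y) 0 i))
  (gamma_gt0 : 0 < gamma)
  (locmin : VP_local_min F f g G gamma (xb, yb))
  (v_lip : dir_lipschitz (moreau f g gamma) (xb, yb) (u, v))
  (crit : critical_cone F f g G gamma (xb, yb) (u, v))
  (calm : VP_calm F f g G gamma (xb, yb) (u, v) \/
          VP_partially_calm F f g G gamma (xb, yb) (u, v))
  (mscq : dir_MSCQ g (xb, yb) (u, v)) :
  exists (alpha : R) (lg : 'rV[R]_p) (lG : 'rV[R]_q),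
    [set grad F (xb, yb) + alpha *: grad f (xb, yb) - alpha *: xi
           + jacT g (xb, yb) lg + jacT G (xb, yb) lG
       | xi in dir_clarke_subdiff (moreau f g gamma) (xb, yb) (u, v)] 0 /\
    [/\ 0 <= alpha,
        vnonneg lg /\ dot lg (g (xb, yb)) = 0,
        dot lg ('d g (xb, yb) (u, v)) = 0,
        vnonneg lG /\ dot lG (G (xb, yb)) = 0 &
        dot lG ('d G (xb, yb) (u, v)) = 0].
Proof.
set zb := (xb, yb) in locmin v_lip crit calm mscq *.
set d := (u, v) in v_lip crit calm mscq *.
have [zb_feas _] := locmin.
have [f_crit F_crit g_crit G_crit] := crit.
have F_d := F_C1.1 zb; have f_d := f_C1.1 zb.
have g_d := g_C1.1 zb; have G_d := G_C1.1 zb.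
have Lp := dir_lipschitz_cone v_lip.
have [rho rho0 Fmin] : exists2 rho, 0 <= rho &
    cone_min F f (moreau f g gamma) (constraint g G) zb d rho.
  have [calm1|calm2] := calm; first exact: calm_cone_min.
  exact: partially_calm_cone_min.
have [r [L Lp']] := Lp; have [_ fzb _ _ _] := Lp'.
rewrite -gradE in F_crit; rewrite -gradE in f_crit.
have c_crit i : constraint g G i zb = 0 -> pdot (constraint_grad g G zb i) d <= 0.
  by case: i => i /=; rewrite comp_gradE; [exact: g_crit|exact: G_crit].
have [alpha [l [xi [[alpha0 l0] lact xiD e0]]]] :=
  penalty_multipliers Lp' rho0 (diff_scalar_cone F_d) (diff_scalar_cone f_d)
    (constraint_diff g_d G_d) (feasible_value_le zb_feas fzb)
    (constraint_le0 zb_feas) F_crit f_crit c_crit Fmin.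
have lc i : l i * constraint g G i zb = 0.
  have [/andP[/eqP -> _]|/lact ->] := boolP (active (constraint g G)
    (constraint_grad g G zb) zb d i); by rewrite ?mulr0 ?mul0r.
have lcd i : l i * pdot (constraint_grad g G zb i) d = 0.
  have [/andP[_ /eqP ->]|/lact ->] := boolP (active (constraint g G)
    (constraint_grad g G zb) zb d i); by rewrite ?mulr0 ?mul0r.
exists alpha, (\row_i l (inl i)), (\row_j l (inr j)); split.
  exists xi => //; rewrite !jacT_sum -[RHS]e0 scalerBr big_sumType/= !addrA.
  by congr (_ + _ + _); apply: eq_bigr => i _; rewrite mxE.
split=> //.
- split=> [i|]; first by rewrite mxE.
  by rewrite /dot big1// => i _; rewrite mxE; exact: (lc (inl i)).
- rewrite /dot big1// => i _; rewrite mxE -comp_gradE.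
  exact: (lcd (inl i)).
- split=> [i|]; first by rewrite mxE.
  by rewrite /dot big1// => i _; rewrite mxE; exact: (lc (inr i)).
- rewrite /dot big1// => i _; rewrite mxE -comp_gradE.
  exact: (lcd (inr i)).
Qed.
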